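(* Let $\{Z(t_i)\}_{1\le i\le n}$ be jointly multivariate normal random variables with $\mathbb{E}Z(t_i)=0$, $\mathbb{E}Z(t_i)^2=1$ for all $i$, and, writing $r_{i,j}:=\mathbb{E}Z(t_i)Z(t_j)$, with $|r_{i,j}|<1$ whenever $i\ne j$. Let $2\le m\le n$, let $u\ge 0$, and suppose $h\ge 0$ is sufficiently small that $$\frac{u-r_{j,m}(u+h)}{\sqrt{1-r_{j,m}^2}}\ge 0\quad\text{for all }1\le j\le m-1.$$ Suppose there exist numbers $c_j=c_j(m,h)>0$ and $d_j=d_j(m,h)>0$, $1\le j\le m-1$, such that: (i) $c_j/d_j$ is a nondecreasing sequence, $1\le j\le m-1$; (ii) $c_{\min\{j,k\}}\,d_{\max\{j,k\}}<r_{j,k}-r_{j,m}r_{k,m}$ for each pair $1\le j,k\le m-1$. Then for any $\delta\ge 0$, $$P(m,h)\ \ge\ \int_{-B(\delta)}^{B(\delta)}\frac{e^{-t^2/2}}{\sqrt{2\pi}}\,dt\ \cdot\ \prod_{j=1}^{m-1}\Phi\Biggl(\frac{(1-\delta)\bigl(u-r_{j,m}(u+h)\bigr)}{\sqrt{1-r_{j,m}^2-c_jd_j}}\Biggr),$$ where $$B(\delta)=\delta\sqrt{\frac{d_{m-1}}{c_{m-1}}}\ \min_{1\le j\le m-1}\frac{u-r_{j,m}(u+h)}{d_j}.$$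
   Context: $\Phi$ denotes the standard normal cumulative distribution function. The quantity $P(m,h)$ is defined by $$P(m,h):=\mathbb{P}\Biggl(V_j\le \frac{u-r_{j,m}(u+h)}{\sqrt{1-r_{j,m}^2}}\ \ \text{for all } 1\le j\le m-1\Biggr),$$ where $V_j=V_{j,m}$ $(1\le j\le m-1)$ are jointly multivariate normal random variables with mean zero, variance one and correlations $$\mathbb{E}V_jV_k=\frac{r_{j,k}-r_{j,m}r_{k,m}}{\sqrt{(1-r_{j,m}^2)(1-r_{k,m}^2)}}.$$ In (ii) the pairs include those with $j=k$. *)

(* Defs.v *)
From HB Require Import structures.
From mathcomp Require Import all_boot all_order all_algebra.
From mathcomp Require Import all_classical all_reals all_analysis.

Set Implicit Arguments.
Unset Strict Implicit.
Unset Printing Implicit Defensive.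

Import Order.TTheory GRing.Theory Num.Theory.
Import numFieldNormedType.Exports.

Local Open Scope classical_set_scope.
Local Open Scope ring_scope.

(* The normal law N(mu, s^2). The case s = 0 is treated apart because the
   library's [normal_prob mu 0] is the uniform law on [0, 1], not the Dirac
   mass at mu. *)
Definition normal_law (R : realType) (mu s : R) (B : set R) : \bar R :=
  if s == 0 then dirac mu B else normal_prob mu s B.

(* Every linear combination is a (possibly degenerate) normal variable. In
   particular singular covariance matrices are allowed. *)
Definition jointly_normal (d : measure_display) (T : measurableType d)
    (R : realType) (P : probability T R) (I : finType)
    (X : I -> {RV P >-> R}) : Prop :=
  forall a : I -> R, exists mu s : R, forall B : set R, measurable B ->
    P [set w | B (\sum_i a i * X i w)] = normal_law mu s B.

Definition Phi (R : realType) (x : R) : R := fine (normal_prob 0 1 `]-oo, x]).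

(* Families indexed by 1, ..., n (or 1, ..., m - 1) are functions on nat, of
   which only the values on that range are ever constrained or used. *)

Definition is_conditional_family (d : measure_display) (T : measurableType d)
    (R : realType) (Q : probability T R) (r : nat -> nat -> R) (m : nat)
    (V : nat -> {RV Q >-> R}) : Prop :=
  [/\ jointly_normal (fun i : 'I_m.-1 => V i.+1),
      forall j, (1 <= j < m)%N -> ('E_Q[V j] = 0)%E,
      forall j, (1 <= j < m)%N -> ('V_Q[V j] = 1)%E &
      forall j k, (1 <= j < m)%N -> (1 <= k < m)%N ->
        'E_Q[V j \* V k]%E =
        ((r j k - r j m * r k m)
           / Num.sqrt ((1 - r j m ^+ 2) * (1 - r k m ^+ 2)))%:E].

(* P(m, h), computed with a given realization V of the variables V_{j,m}. *)
Definition Pmh (d : measure_display) (T : measurableType d)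
    (R : realType) (Q : probability T R) (r : nat -> nat -> R) (u : R)
    (V : nat -> {RV Q >-> R}) (m : nat) (h : R) : \bar R :=
  Q [set w | forall j, (1 <= j < m)%N ->
       V j w <= (u - r j m * (u + h)) / Num.sqrt (1 - r j m ^+ 2)].

(* The minimum over 1 <= j <= m - 1; for m >= 2 the seed of the iterated
   minimum, the term of index 1, belongs to the range. *)
Definition min_range (R : realType) (m : nat) (F : nat -> R) : R :=
  \big[Num.min/F 1%N]_(1 <= j < m) F j.

Definition Bdelta (R : realType) (r : nat -> nat -> R) (u h : R) (m : nat)
    (c d : nat -> R) (delta : R) : R :=
  delta * Num.sqrt (d m.-1 / c m.-1)
    * min_range m (fun j => (u - r j m * (u + h)) / d j).

(* Main.v *)
Require Import Defs.
From HB Require Import structures.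
From mathcomp Require Import all_boot all_order all_algebra.
From mathcomp Require Import all_classical all_reals all_analysis.
From mathcomp Require Import measurable_realfun.
From mathcomp Require Import ring lra zify.

Import Order.TTheory GRing.Theory Num.Theory.
Import numFieldNormedType.Exports.

Local Open Scope classical_set_scope.
Local Open Scope ring_scope.

(** Slepian's inequality compares [P(m, h)] with the same probability for
    W_j = d_j X(c_j / d_j) + N_j, where X is a Brownian motion and the N_j are
    independent noises: by (ii) and the monotonicity of c_j / d_j the covariance
    of W lies below that of the given variables off the diagonal and agrees with
    it on the diagonal. The event X <= b up to the time c_{m-1} / d_{m-1}, with
    b = delta * min (u - r_{j,m} (u + h)) / d_j, uses up a fraction delta of
    each threshold and leaves the factors Phi to the noises; by the reflection
    principle its probability is at least the Gaussian integral over
    [-B(delta), B(delta)].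

    Joint laws are only handled through their characteristic functions. In
    Slepian's interpolation argument the indicators are replaced by products of
    trigonometric polynomials in one variable each, whose mixed derivatives are
    nonnegative up to a quadratic error of size o(1); this needs neither
    densities nor the uniqueness theorem for characteristic functions. *)

Set Implicit Arguments.
Unset Strict Implicit.
Unset Printing Implicit Defensive.

(** * Expectations of bounded measurable functions *)

(** A trigonometric polynomial is periodic, so such an approximation of an indicator cannot be
    monotone, and the sign of the mixed derivatives fails far from the threshold. In [phi], with
    exponent n and frequency k, the slope is at most 2nk. A wrong sign requires |k (x_i - c_i)| > 1
    for some coordinate, and there the product of two slopes is at least -(2nk)^2 >= -(2nk)^2 k^2 |x
    - c|^2. Second moments being bounded, the total error is of order (n k^2)^2. It has to vanish
    while the transition is completed within a distance 1/L of the centre, that is, while n k / L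
    tends to infinity. The choice n = L^5, k = L^-3 gives n k^2 = 1/L and n k / L = L. This balance
    relies on a slope that is linear in n although [phi] is a power with exponent 2^n.

    Phases replace complex numbers: cos (a . x + th) for all th carries both parts of the
    characteristic function. A derivative rotates the phase by a quarter turn, and in Fubini's
    theorem the outer variable joins the phase of the inner integral. *)

Section bounded_measurable.
Context d (T : measurableType d) (R : realType).
Implicit Types f g : T -> R.

(** Such functions are integrable for every probability, so integrability conditions reduce to
    closure properties. *)
Definition bmeas f :=
  measurable_fun setT f /\ exists M : R, forall x, `|f x| <= M.

Lemma bmeas_cst c : bmeas (fun=> c).
Proof. by split; [exact: measurable_cst | exists `|c|]. Qed.

Lemma bmeasD f g : bmeas f -> bmeas g -> bmeas (fun x => f x + g x).
Proof.
move=> [mf [M fM]] [mg [N gN]]; split; first exact: measurable_funD.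
by exists (M + N) => x; rewrite (le_trans (ler_normD _ _))// lerD.
Qed.

Lemma bmeasM f g : bmeas f -> bmeas g -> bmeas (fun x => f x * g x).
Proof.
move=> [mf [M fM]] [mg [N gN]]; split; first exact: measurable_funM.
by exists (M * N) => x; rewrite normrM ler_pM.
Qed.

Lemma bmeasZ c f : bmeas f -> bmeas (fun x => c * f x).
Proof. by move=> bf; apply: bmeasM => //; exact: bmeas_cst. Qed.

Lemma bmeasN f : bmeas f -> bmeas (fun x => - f x).
Proof.
move=> [mf [M fM]]; split; first exact: measurable_funN.
by exists M => x; rewrite normrN.
Qed.

Lemma bmeasB f g : bmeas f -> bmeas g -> bmeas (fun x => f x - g x).
Proof. by move=> bf bg; apply: bmeasD => //; exact: bmeasN. Qed.

Lemma bmeas_sum I (r : seq I) (F : I -> T -> R) :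
  (forall i, bmeas (F i)) -> bmeas (fun x => \sum_(i <- r) F i x).
Proof.
move=> bF; elim: r => [|i r IH].
  by under [X in bmeas X]eq_fun do rewrite big_nil; exact: bmeas_cst.
by under [X in bmeas X]eq_fun do rewrite big_cons; exact: bmeasD.
Qed.

Lemma bmeas_prod I (r : seq I) (F : I -> T -> R) :
  (forall i, bmeas (F i)) -> bmeas (fun x => \prod_(i <- r) F i x).
Proof.
move=> bF; elim: r => [|i r IH].
  by under [X in bmeas X]eq_fun do rewrite big_nil; exact: bmeas_cst.
by under [X in bmeas X]eq_fun do rewrite big_cons; exact: bmeasM.
Qed.

Lemma bmeas_indic (A : set T) : measurable A -> bmeas (\1_A : T -> R).
Proof.
move=> mA; split; first exact: measurable_indic.
by exists 1 => x; rewrite indicE; case: (_ \in _); rewrite ?normr1 ?normr0.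
Qed.

End bounded_measurable.

Lemma bmeas_comp d d' (T : measurableType d) (T' : measurableType d')
    (R : realType) (f : T' -> R) (g : T -> T') :
  bmeas f -> measurable_fun setT g -> bmeas (fun x => f (g x)).
Proof.
move=> [mf [M fM]] mg; split; first exact: (measurableT_comp mf mg).
by exists M => x.
Qed.

Section expectation.
Context d (T : measurableType d) (R : realType) (P : probability T R).
Implicit Types f g : T -> R.

Lemma bmeas_integrable f : bmeas f -> P.-integrable setT (EFin \o f).
Proof.
move=> [mf [M fM]]; apply: measurable_bounded_integrable => //.
  by rewrite (le_lt_trans (probability_le1 _ _))// ltry.
exists M; split; first exact: num_real.
by move=> y My x _; apply: le_trans (ltW My).
Qed.

Lemma Rint_cst c : \int[P]_x c = c.
Proof.
rewrite (Rintegral_cst P measurableT c).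
by rewrite (congr1 fine (probability_setT P)) mulr1.
Qed.

Lemma RintB f g : bmeas f -> bmeas g ->
  \int[P]_x (f x - g x) = \int[P]_x f x - \int[P]_x g x.
Proof. by move=> bf bg; rewrite RintegralB//; exact: bmeas_integrable. Qed.

Lemma RintZ c f : bmeas f -> \int[P]_x (c * f x) = c * \int[P]_x f x.
Proof. by move=> bf; rewrite RintegralZl//; exact: bmeas_integrable. Qed.

Lemma integrable_Rsum I (r : seq I) (F : I -> T -> R) :
  (forall i, P.-integrable setT (EFin \o F i)) ->
  P.-integrable setT (EFin \o (fun x => \sum_(i <- r) F i x)) /\
  \int[P]_x (\sum_(i <- r) F i x) = \sum_(i <- r) \int[P]_x F i x.
Proof.
move=> iF; elim: r => [|i r [IH1 IH2]].
  rewrite big_nil; split; last first.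
    by under eq_Rintegral do rewrite big_nil; rewrite Rint_cst.
  under [X in _.-integrable _ (EFin \o X)]eq_fun do rewrite big_nil.
  exact/bmeas_integrable/bmeas_cst.
split.
  under [X in _.-integrable _ (EFin \o X)]eq_fun do rewrite big_cons.
  exact: (integrableD measurableT (iF i) IH1).
under eq_Rintegral do rewrite big_cons.
by rewrite RintegralD// IH2 big_cons.
Qed.

Lemma Rint_sum I (r : seq I) (F : I -> T -> R) : (forall i, bmeas (F i)) ->
  \int[P]_x (\sum_(i <- r) F i x) = \sum_(i <- r) \int[P]_x F i x.
Proof.
by move=> bF; apply: (integrable_Rsum _ _).2 => i; exact: bmeas_integrable.
Qed.

Lemma le_Rint f g : bmeas f -> bmeas g -> (forall x, f x <= g x) ->
  \int[P]_x f x <= \int[P]_x g x.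
Proof.
by move=> bf bg fg; apply: le_Rintegral => //; exact: bmeas_integrable.
Qed.

Lemma Rint_indic (A : set T) : measurable A -> \int[P]_x (\1_A x) = fine (P A).
Proof. by move=> mA; rewrite /Rintegral integral_indic// setIT. Qed.

Lemma cvg_Rint_dom (f_ : nat -> T -> R) f (g : T -> R) :
  (forall n, measurable_fun setT (f_ n)) ->
  P.-integrable setT (EFin \o g) ->
  (forall n x, `|f_ n x| <= g x) ->
  (forall x, f_ n x @[n --> \oo] --> f x) ->
  \int[P]_x f_ n x @[n --> \oo] --> \int[P]_x f x.
Proof.
move=> mf ig fg ff.
have mlim : measurable_fun setT f.
  by apply: (measurable_fun_cvg mf) => x _; exact: ff.
have [] := @dominated_convergence _ _ _ P setT measurableT
  (fun n x => (f_ n x)%:E) (EFin \o f) (EFin \o g).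
- by move=> n; apply/measurable_EFinP.
- exact/measurable_EFinP.
- apply: aeW => x _; apply: cvg_EFin; first exact: nearW.
  exact: ff.
- exact: ig.
- by apply: aeW => x n _; rewrite /= lee_fin.
- move=> intf _ cvf; apply: fine_cvg; rewrite fineK//.
  exact: integrable_fin_num intf.
Qed.

Lemma cvg_Rint (f_ : nat -> T -> R) f (M : R) :
  (forall n, measurable_fun setT (f_ n)) ->
  (forall n x, `|f_ n x| <= M) ->
  (forall x, f_ n x @[n --> \oo] --> f x) ->
  \int[P]_x f_ n x @[n --> \oo] --> \int[P]_x f x.
Proof.
move=> mf fM ff; apply: (cvg_Rint_dom (g := cst M)) => //.
exact/bmeas_integrable/bmeas_cst.
Qed.

End expectation.

Section product_probability.
Context d1 d2 (T1 : measurableType d1) (T2 : measurableType d2) (R : realType).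
Variables (P1 : probability T1 R) (P2 : probability T2 R).

(** A name of its own lets the product carry the structure of a probability, so that products can be
    iterated. *)
Definition prodP : set (T1 * T2) -> \bar R := (P1 \x P2)%E.

HB.instance Definition _ := Measure.on prodP.

Let prodP_setT : prodP setT = 1%E.
Proof.
rewrite -setXTT /prodP product_measure1E//.
rewrite -[RHS]mule1; congr (_ * _)%E; exact: probability_setT.
Qed.

HB.instance Definition _ := Measure_isProbability.Build _ _ _ prodP prodP_setT.

Variable f : T1 * T2 -> R.
Hypothesis bf : bmeas f.

Lemma bmeas_section x : bmeas (fun y => f (x, y)).
Proof. exact: (bmeas_comp bf (measurable_pair1 x)). Qed.

Lemma Rint_prod : \int[prodP]_z f z = \int[P1]_x \int[P2]_y f (x, y).
Proof.
rewrite /Rintegral -(integral12_prod_meas1 (f := EFin \o f)).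
  congr fine; apply: eq_integral => x _.
  rewrite fineK//; apply: integrable_fin_num => //.
  exact/bmeas_integrable/bmeas_section.
exact: (bmeas_integrable prodP bf).
Qed.

Lemma bmeas_Rint : bmeas (fun x => \int[P2]_y f (x, y)).
Proof.
case: (bf) => mf [M fM]; split.
  apply: (measurableT_comp (fine_measurable measurableT)).
  have := @measurable_fubini_F _ _ _ _ _ P1 P2 (EFin \o f).
  apply; exact: (bmeas_integrable prodP bf).
exists M => x.
apply: le_trans (le_normr_Rintegral _ _) _ => //.
  exact/bmeas_integrable/bmeas_section.
rewrite -[leRHS](Rint_cst P2); apply: le_Rint => //; last exact: bmeas_cst.
by have [ms _] := bmeas_section x; split;
  [exact: measurableT_comp | exists M => y; rewrite normr_id].
Qed.

End product_probability.

(** * The characteristic function of a normal law *)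

Lemma integrable_cM d (T : measurableType d) (R : realType)
    (P : {measure set T -> \bar R}) (f : T -> R) (c : R) :
  P.-integrable setT (fun x => (f x)%:E) ->
  P.-integrable setT (fun x => (c * f x)%:E).
Proof.
by move=> fi; under eq_fun do rewrite EFinM; exact: integrableZl.
Qed.

Section real_line.
Variable R : realType.
Local Notation mu := (@lebesgue_measure R).

(** The fundamental theorem of calculus on the growing intervals [I n], passed to the limit by
    dominated convergence. It stands in for integration by parts on the whole line. *)
Lemma Rintegral_derive_eq0 (F f : R -> R) :
  (forall x : R, is_derive x (1 : R) F (f x)) -> continuous f ->
  mu.-integrable setT (EFin \o f) ->
  F n%:R @[n --> \oo] --> 0 -> F (- n%:R) @[n --> \oo] --> 0 ->
  \int[mu]_x f x = 0.
Proof.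
move=> dF cf intf Fy FNy.
pose I n := `[- n.+1%:R, n.+1%:R : R]%classic.
have mf : measurable_fun setT f by case/integrableP : intf => /measurable_EFinP.
have cvI : \int[mu]_(x in I n) f x @[n --> \oo] --> \int[mu]_x f x.
  apply: fine_cvg; rewrite fineK; last exact: integrable_fin_num.
  have [] := @dominated_convergence _ _ _ mu setT measurableT
    (fun n => (EFin \o f) \_ (I n)) (EFin \o f) (fun x => `|(f x)%:E|%E).
  - move=> n; apply/(measurable_restrictT _ _).1 => //.
      exact: measurable_itv.
    by apply: measurable_funTS; exact/measurable_EFinP.
  - exact/measurable_EFinP.
  - apply: aeW => x _; apply: cvg_near_cst.
    have [N _ HN] : \forall n \near \oo, `|x| <= n%:R :> R by exact: nbhs_infty_ger.
    exists N => // n /= Nn; rewrite patchE ifT// inE /I/= in_itv/=.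
    rewrite -ler_norml (le_trans (HN _ Nn))// ler_nat//.
  - exact: integrable_abse.
  - apply: aeW => x n _; rewrite patchE; case: ifP => // _.
    by rewrite abse0.
  move=> _ _; apply: cvg_trans; apply: near_eq_cvg; apply: nearW => n.
  by rewrite [RHS]integral_mkcond.
have cvF : \int[mu]_(x in I n) f x @[n --> \oo] --> (0 - 0 : R).
  rewrite (_ : (fun n => _) = (fun n => F n.+1%:R - F (- n.+1%:R))).
    apply: cvgB; first by rewrite -(cvg_shiftS (fun n => F n%:R)) in Fy.
    by rewrite -(cvg_shiftS (fun n => F (- n%:R))) in FNy.
  apply/funext => n; rewrite /Rintegral /I.
  have cF x : {for x, continuous F}.
    exact/differentiable_continuous/derivable1_diffP/ex_derive.
  rewrite (continuous_FTC2 (F := F))//.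
  - by rewrite gtrN// ltr0n.
  - exact: continuous_subspaceT.
  - split=> [x _||]; first exact: ex_derive.
    + apply: cvg_at_right_filter; exact: cF.
    + apply: cvg_at_left_filter; exact: cF.
  - by move=> x _; rewrite derive1E; exact: derive_val.
by rewrite (cvg_unique _ cvI cvF)// subrr.
Qed.

Variables m s : R.
Hypothesis s0 : s != 0.
Local Notation p := (normal_pdf m s).

Let s2_gt0 : 0 < s ^+ 2.
Proof. by rewrite exprn_even_gt0. Qed.

Lemma is_derive_normal_pdf x :
  is_derive (x : R) (1 : R) p (- ((x - m) / s ^+ 2 * p x)).
Proof.
rewrite normal_pdfE//= /normal_fun.
have s2 := gt_eqF s2_gt0.
apply: is_derive_eq => //=.
rewrite /GRing.scale /=.
by field; rewrite s0.
Qed.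

(** With y = x - m, doubling the standard deviation leaves a spare factor exp (-3 y^2 / (8 s^2)),
    which absorbs |y| <= 1 + y^2. The right side is the integrable majorant for differentiating
    under the integral. *)
Lemma normal_pdf_moment_le x :
  `|x - m| * p x <= ((1 + 8 / 3 * s ^+ 2) * normal_peak s / normal_peak (2 * s))
    * normal_pdf m (2 * s) x.
Proof.
have s20 : 2 * s != 0 by rewrite mulf_neq0.
have p0 := normal_peak_gt0 s20.
rewrite !normal_pdfE//= [leRHS](_ : _ =
  normal_peak s * ((1 + 8 / 3 * s ^+ 2) * normal_fun m (2 * s) x)); last first.
  by field; rewrite gt_eqF.
rewrite mulrCA ler_wpM2l ?normal_peak_ge0// /normal_fun.
set y := x - m.
have -> : - y ^+ 2 / (s ^+ 2 *+ 2) =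
    - y ^+ 2 / ((2 * s) ^+ 2 *+ 2) - 3 / 8 * (y ^+ 2 / s ^+ 2).
  by field; rewrite s0.
rewrite expRD; set e := expR (- y ^+ 2 / _).
rewrite (mulrCA _ e) (mulrC _ e) ler_wpM2l ?expR_ge0// expRN ler_pdivrMr ?expR_gt0//.
set w := 3 / 8 * (y ^+ 2 / s ^+ 2).
have w0 : 0 <= w.
  by rewrite /w mulr_ge0 ?divr_ge0 ?sqr_ge0//; lra.
have ew : 1 + w <= expR w by exact: expR_ge1Dx.
have yw : y ^+ 2 = 8 / 3 * s ^+ 2 * w by rewrite /w; field; rewrite s0.
have ny : `|y| <= 1 + y ^+ 2.
  rewrite -(real_normK (num_real y)); have := normr_ge0 y; nra.
apply: le_trans ny _; rewrite yw.
have c0 : 0 <= 8 / 3 * s ^+ 2 by nra.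
apply: (@le_trans _ _ ((1 + 8 / 3 * s ^+ 2) * (1 + w))); first by nra.
by rewrite ler_wpM2l// addr_ge0.
Qed.

(** The moment bound gives p (v) |v - m| <= K. The hypothesis on [v] covers both v n = n and v n =
    -n. *)
Lemma cvg_normal_pdf0 (v : nat -> R) : (forall n, n%:R - `|m| <= `|v n - m|) ->
  p (v n) @[n --> \oo] --> 0.
Proof.
move=> vm; set C := ((1 + 8 / 3 * s ^+ 2) * normal_peak s / normal_peak (2 * s)).
have s20 : 2 * s != 0 by rewrite mulf_neq0.
pose K := C * normal_peak (2 * s).
apply/cvgr0Pnorm_le => e e0; near=> n.
have nm : `|m| + K / e + 1 <= n%:R by near: n; exact: nbhs_infty_ger.
rewrite ger0_norm ?normal_pdf_ge0//.
have C0 : 0 <= C.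
  by rewrite /C divr_ge0 ?normal_peak_ge0// mulr_ge0 ?normal_peak_ge0//; nra.
have K0 : 0 <= K by rewrite mulr_ge0 ?normal_peak_ge0.
have vK : `|v n - m| * p (v n) <= K.
  rewrite (le_trans (normal_pdf_moment_le _))// ler_wpM2l//.
  exact: normal_pdf_ub.
have p0 : 0 <= p (v n) by exact: normal_pdf_ge0.
have v1 : K / e + 1 <= `|v n - m| by have := vm n; lra.
have Ke : 0 <= K / e by rewrite divr_ge0// ltW.
have K_eq : K = e * (K / e) by field; rewrite gt_eqF.
rewrite leNgt; apply/negP => ep.
by move: K_eq v1 vK; move: (K / e) Ke ep => k; nra.
Unshelve. all: by end_near. Qed.

Let trig_integrable (g : R -> R) : measurable_fun setT g ->
  (forall x, `|g x| <= 1) ->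
  mu.-integrable setT (fun x => (g x * p x)%:E) /\
  mu.-integrable setT (fun x => ((x - m) * g x * p x)%:E).
Proof.
move=> mg g1; split.
  apply: le_integrable (integrable_normal_pdf m s) => //.
    apply/measurable_EFinP/measurable_funM => //.
    exact: measurable_normal_pdf.
  move=> x _ /=; rewrite lee_fin normrM ler_piMl//.
apply: (@le_integrable _ _ _ mu setT _ _ (fun x =>
  (((1 + 8 / 3 * s ^+ 2) * normal_peak s / normal_peak (2 * s))
    * normal_pdf m (2 * s) x)%:E)) => //.
- apply/measurable_EFinP/measurable_funM.
    by apply: measurable_funM => //; apply: measurable_funB.
  exact: measurable_normal_pdf.
- move=> x _ /=; rewrite lee_fin; apply: le_trans (ler_norm _).
  apply: le_trans (normal_pdf_moment_le x).
  rewrite mulrAC normrM -[leRHS]mulr1 ler_pM// normrM.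
  by rewrite (ger0_norm (normal_pdf_ge0 _ _ _)).
- apply: integrable_cM; exact: integrable_normal_pdf.
Qed.

Variable th : R.
Let H t := \int[mu]_x (cos (t * (x - m) + th) * p x).

Let is_derive_H (t : R) : is_derive t (1 : R) H (- (s ^+ 2 * t * H t)).
Proof.
pose f t x := cos (t * (x - m) + th) * p x.
have caff t' (x : R) : {for x, continuous (fun x => t' * (x - m) + th)}.
  apply: cvgD; last exact: cvg_cst.
  by apply: cvgM; [exact: cvg_cst | apply: cvgB; [exact: cvg_id | exact: cvg_cst]].
have mcos t' : measurable_fun setT (fun x : R => cos (t' * (x - m) + th)).
  apply: continuous_measurable_fun => x.
  apply: continuous_comp; last exact: continuous_cos.
  exact: caff.
have msin t' : measurable_fun setT (fun x : R => sin (t' * (x - m) + th)).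
  apply: continuous_measurable_fun => x.
  apply: continuous_comp; last exact: continuous_sin.
  exact: caff.
have df t' x : is_derive (t' : R) (1 : R) (f^~ x)
    (- ((x - m) * sin (t' * (x - m) + th) * p x)).
  rewrite /f; apply: is_derive_eq => //=.
  by rewrite /GRing.scale /=; ring.
have d1f t' x : partial1of2 f t' x = - ((x - m) * sin (t' * (x - m) + th) * p x).
  by rewrite partial1of2E; exact: derive_val.
have tin : `]t - 1, t + 1[%classic t.
  by rewrite /= in_itv/= ltrBlDr ltrDl ltr01.
pose C := ((1 + 8 / 3 * s ^+ 2) * normal_peak s / normal_peak (2 * s)).
pose G x := C * normal_pdf m (2 * s) x.
have C0 : 0 <= C.
  by rewrite /C divr_ge0 ?normal_peak_ge0// mulr_ge0 ?normal_peak_ge0//; nra.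
have G0 x : 0 <= G x by rewrite mulr_ge0// normal_pdf_ge0.
have iG : mu.-integrable setT (EFin \o G).
  by apply: integrable_cM; exact: integrable_normal_pdf.
have fi t' : `]t - 1, t + 1[%classic t' -> mu.-integrable setT (EFin \o f t').
  by move=> _; apply: (trig_integrable (mcos t') _).1 => x; exact: cos_max.
have fd t' x : `]t - 1, t + 1[%classic t' -> setT x -> derivable (f^~ x) t' 1.
  by move=> _ _; exact: ex_derive.
have fG t' x : `]t - 1, t + 1[%classic t' -> setT x -> `|partial1of2 f t' x| <= G x.
  move=> _ _; rewrite d1f normrN; apply: le_trans (normal_pdf_moment_le x).
  rewrite mulrAC normrM -[leRHS]mulr1 ler_pM//; last exact: sin_max.
  by rewrite normrM (ger0_norm (normal_pdf_ge0 _ _ _)).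
have dH := derivable_under_integral measurableT tin fi fd G0 iG fG.
have := differentiation_under_integral measurableT tin fi fd G0 iG fG.
rewrite -/H derive1E => vH; apply: DeriveDef => //.
rewrite vH; under eq_Rintegral do rewrite d1f.
have [_ isin] := trig_integrable (msin t) (fun x => sin_max _).
have [icos _] := trig_integrable (mcos t) (fun x => cos_max _).
(* Since p' = -(x - m) p / s^2, the integral of F' is the difference between the integral of (x - m)
   sin (..) p and s^2 t H; it vanishes because F does at infinity. *)
pose F x := - (s ^+ 2) * (p x * sin (t * (x - m) + th)).
have dF (x : R) : is_derive x (1 : R) F
    ((x - m) * sin (t * (x - m) + th) * p x - s ^+ 2 * t * f t x).
  rewrite /F; have dp := is_derive_normal_pdf x.
  apply: is_derive_eq => //=.
  by rewrite /f /GRing.scale /=; field.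
have F0 v : (forall n, n%:R - `|m| <= `|v n - m|) -> F (v n) @[n --> \oo] --> 0.
  move=> vm; apply/cvgr0Pnorm_le => e e0.
  have /cvgr0Pnorm_le := cvg_normal_pdf0 vm.
  move=> /(_ (e / s ^+ 2)); rewrite divr_gt0// => /(_ isT).
  apply: filterS => n; rewrite ler_pdivlMr// => pe.
  rewrite /F normrM normrN (gtr0_norm s2_gt0) normrM mulrC.
  by rewrite (le_trans _ pe)// ler_wpM2r ?(ltW s2_gt0)// ler_piMr// sin_max.
have ifull : mu.-integrable setT (EFin \o (fun x =>
    (x - m) * sin (t * (x - m) + th) * p x - s ^+ 2 * t * f t x)).
  rewrite (_ : _ \o _ = ((fun x => ((x - m) * sin (t * (x - m) + th) * p x)%:E)
    \- (fun x => (s ^+ 2 * t)%:E * (f t x)%:E))%E)//.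
  by apply: integrableB => //; exact: integrable_cM.
have cf : continuous (fun x : R =>
    (x - m) * sin (t * (x - m) + th) * p x - s ^+ 2 * t * f t x).
  move=> x; apply/differentiable_continuous/derivable1_diffP.
  have dp := is_derive_normal_pdf x; rewrite /f.
  exact: ex_derive.
have if' := integrable_cM (s ^+ 2 * t) icos.
have E : \int[mu]_x ((x - m) * sin (t * (x - m) + th) * p x - s ^+ 2 * t * f t x) = 0.
  apply: (Rintegral_derive_eq0 dF cf ifull); apply: F0 => n.
    by rewrite -[n%:R in leLHS]ger0_norm//; exact: lerB_dist.
  rewrite (_ : _ - m = - (n%:R + m)) ?normrN; last by ring.
  rewrite lerBlDr -[n%:R in leLHS]ger0_norm// -[in leLHS](addrK m n%:R).
  exact: ler_normB.
rewrite (RintegralB measurableT isin if') in E.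
rewrite (RintegralZl (s ^+ 2 * t) measurableT icos) -/(H t) in E.
have -> : \int[mu]_x (- ((x - m) * sin (t * (x - m) + th) * p x)) =
   - \int[mu]_x ((x - m) * sin (t * (x - m) + th) * p x).
  by under eq_Rintegral do rewrite -mulN1r; rewrite (RintegralZl (-1) measurableT isin) mulN1r.
by congr (- _); apply/eqP; rewrite -subr_eq0 E.
Qed.

(** The equation H' = -s^2 t H makes H (t) exp (s^2 t^2 / 2) constant, with value cos th at t =
    0. *)
Lemma normal_pdf_charfun t :
  \int[mu]_x (cos (t * (x - m) + th) * p x) =
  cos th * expR (- (s ^+ 2 * t ^+ 2 / 2)).
Proof.
rewrite -/(H t).
have dK (x : R) : is_derive x (1 : R) (fun t => H t * expR (s ^+ 2 * t ^+ 2 / 2)) 0.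
  have dHx := is_derive_H x.
  apply: is_derive_eq => /=.
  by rewrite /GRing.scale /=; field.
have := is_derive_0_is_cst t 0 dK.
rewrite expr0n/= mulr0 mul0r expR0 mulr1.
have -> : H 0 = cos th.
  rewrite /H; under eq_Rintegral do rewrite mul0r add0r.
  rewrite (RintegralZl (cos th) measurableT (integrable_normal_pdf m s)).
  by rewrite /Rintegral integral_normal_pdf mulr1.
by move=> <-; rewrite expRN mulfK// gt_eqF// expR_gt0.
Qed.

End real_line.

Section normal_prob_integral.
Variables (R : realType) (m s : R).
Local Notation mu := (@lebesgue_measure R).

(** The Radon-Nikodym derivative is known through its integrals over measurable sets, which identify
    it almost everywhere with the density. *)
Lemma Rintegral_normal_prob (f : R -> R) : bmeas f ->
  \int[normal_prob m s]_x f x = \int[mu]_x (f x * normal_pdf m s x).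
Proof.
move=> bf; have intf := bmeas_integrable (normal_prob m s) bf.
have dom := normal_prob_dominates m s.
rewrite /Rintegral; congr fine.
rewrite -(Radon_Nikodym_change_of_variables dom)//=.
apply: ae_eq_integral => //.
- apply: emeasurable_funM => //; exact: measurable_int intf.
- apply/measurable_EFinP/measurable_funM; first by case: bf.
  exact: measurable_normal_pdf.
- under [X in ae_eq _ _ _ X]eq_fun do rewrite EFinM.
  apply: ae_eqe_mul2l => /=.
  apply: integral_ae_eq => //=.
  + exact: Radon_Nikodym_integrable.
  + by apply/measurable_EFinP; exact: measurable_normal_pdf.
  + by move=> E E01 mE; rewrite -Radon_Nikodym_integral.
Qed.

End normal_prob_integral.

(** * Scaling limits that recover moments from characteristic functions *)

Section trig_limits.
Variable R : realType.
Implicit Types x y h : R.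

Lemma sin_mvt x : exists2 c, `|c| <= `|x| & sin x = x * cos c.
Proof.
have pos y : 0 < y -> exists2 c, `|c| <= `|y| & sin y = y * cos c.
  move=> y0; have cs : {within `[0, y], continuous (@sin R)}.
    by apply: continuous_subspaceT; exact: continuous_sin.
  have [c cy E] := MVT y0 (fun z _ => is_derive_sin z) cs.
  move: cy; rewrite in_itv/= => /andP[c0 cy]; exists c.
    by rewrite !gtr0_norm// ltW.
  by move: E; rewrite sin0 !subr0 mulrC.
have [x0|x0|->] := ltgtP x 0; last by exists 0; rewrite ?sin0 ?mul0r.
- have [|c cx E] := pos (- x); first by rewrite oppr_gt0.
  exists c; first by rewrite -[leRHS]normrN.
  by apply: oppr_inj; rewrite -sinN E mulNr.
- exact: pos.
Qed.

Lemma ler_norm_sin x : `|sin x| <= `|x|.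
Proof. by have [c _ ->] := sin_mvt x; rewrite normrM ler_piMr// cos_max. Qed.

Lemma cvg_rescale (g : R -> R) (l : R) (h : nat -> R) :
  is_derive (0 : R) (1 : R) g l -> (forall n, h n != 0) ->
  h n @[n --> \oo] --> 0 -> (g (h n) - g 0) / h n @[n --> \oo] --> l.
Proof.
move=> dg h0 hc.
have [/cvg_ex[/= l' gl']] := dg.
have gl : 'D_1 g 0 = l' by exact/cvg_lim.
rewrite gl => ll; rewrite -ll.
have /cvgr_dnbhsP/(_ h)/(_ (conj h0 hc)) := gl'.
apply: cvg_trans; apply: near_eq_cvg; apply: nearW => n /=.
by rewrite addr0 /GRing.scale /= mulr1 mulrC.
Qed.

Lemma cvg_sin_scale x : n.+1%:R * sin (x / n.+1%:R) @[n --> \oo] --> x.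
Proof.
have dg : is_derive (0 : R) (1 : R) (fun h => sin (x * h)) x.
  apply: is_derive_eq => /=.
  by rewrite /GRing.scale/= mulr0 cos0; ring.
have := cvg_rescale dg (fun n => lt0r_neq0 (harmonic_gt0 n)) cvg_harmonic.
apply: cvg_trans; apply: near_eq_cvg; apply: nearW => n /=.
by rewrite mulr0 sin0 subr0 invrK mulrC.
Qed.

Lemma onem_cosE x : 1 - cos x = 2 * sin (x / 2) ^+ 2.
Proof.
have := cosD (x / 2) (x / 2); rewrite -splitr => ->.
by rewrite -!expr2 cos2sin2; ring.
Qed.

Lemma cvg_onem_cos_scale x :
  2 * n.+1%:R ^+ 2 * (1 - cos (x / n.+1%:R)) @[n --> \oo] --> x ^+ 2.
Proof.
have c2 := @cvg_sin_scale (x / 2).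
have -> : x ^+ 2 = 2 ^+ 2 * ((x / 2) * (x / 2)) by field.
rewrite (_ : (fun n => _) = (fun n => 2 ^+ 2 *
    ((n.+1%:R * sin (x / 2 / n.+1%:R)) * (n.+1%:R * sin (x / 2 / n.+1%:R))))).
  by apply: cvgM; [exact: cvg_cst | exact: cvgM].
by apply/funext => n; rewrite onem_cosE (mulrAC x); ring.
Qed.

(** The upper bound is the majorant for dominated convergence; nonnegativity allows Fatou's
    lemma. *)
Lemma onem_cos_scale_bound x n :
  0 <= 2 * n.+1%:R ^+ 2 * (1 - cos (x / n.+1%:R)) <= x ^+ 2.
Proof.
rewrite onem_cosE; set y := x / _ / 2.
have -> : 2 * n.+1%:R ^+ 2 * (2 * sin y ^+ 2) = 4 * n.+1%:R ^+ 2 * sin y ^+ 2.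
  by ring.
rewrite mulr_ge0 ?sqr_ge0 ?mulr_ge0//=.
have -> : x ^+ 2 = 4 * n.+1%:R ^+ 2 * y ^+ 2 by rewrite /y; field.
rewrite ler_wpM2l ?mulr_ge0// ?sqr_ge0//.
by rewrite -(real_normK (num_real (sin y))) -(real_normK (num_real y)) lerXn2r ?nnegrE// ler_norm_sin.
Qed.

Lemma cvg_onem_exp_scale y :
  2 * n.+1%:R ^+ 2 * (1 - expR (- (y * n.+1%:R^-1 ^+ 2 / 2))) @[n --> \oo] --> y.
Proof.
have dg : is_derive (0 : R) (1 : R) (fun h => 2 * (1 - expR (- (y * h / 2)))) y.
  apply: is_derive_eq => /=.
  by rewrite /GRing.scale/= mulr0 mul0r oppr0 expR0; field.
have h2 : (harmonic n ^+ 2 : R) @[n --> \oo] --> 0.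
  by rewrite -[0 in X in _ --> X](mulr0 0); apply: cvgM; exact: cvg_harmonic.
have := cvg_rescale dg _ h2.
move=> /(_ (fun n => expf_neq0 2 (lt0r_neq0 (harmonic_gt0 n)))).
apply: cvg_trans; apply: near_eq_cvg; apply: nearW => n /=.
by rewrite mulr0 mul0r oppr0 expR0; field.
Qed.

End trig_limits.

(** * Gaussian families *)

(** [q a] is the variance of the combination with coefficients a. The phases th = 0 and th = -pi/2
    give the real and the imaginary part of the characteristic function. *)
Definition gaussian d (T : measurableType d) (R : realType)
    (P : probability T R) (I : finType) (X : I -> T -> R)
    (q : (I -> R) -> R) : Prop :=
  (forall i, measurable_fun setT (X i)) /\
  forall (a : I -> R) (th : R),
    \int[P]_w cos (\sum_i a i * X i w + th) = cos th * expR (- (q a / 2)).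

Lemma measurable_cosD d (T : measurableType d) (R : realType) (f : T -> R) th :
  measurable_fun setT f -> measurable_fun setT (fun w => cos (f w + th)).
Proof.
move=> mf; apply: (measurableT_comp (continuous_measurable_fun (@continuous_cos R))).
exact: measurable_funD.
Qed.

Lemma bmeas_cosD d (T : measurableType d) (R : realType) (f : T -> R) th :
  measurable_fun setT f -> bmeas (fun w => cos (f w + th)).
Proof.
by move=> mf; split; [exact: measurable_cosD | exists 1 => w; exact: cos_max].
Qed.

Section normal_law.
Context d (T : measurableType d) (R : realType) (P : probability T R).
Variables (X : T -> R) (m s : R).
Hypothesis mX : measurable_fun setT X.
Hypothesis lawX : forall B : set R, measurable B ->
  P [set w | B (X w)] = normal_law m s B.

Lemma normal_law_charfun t th :
  \int[P]_w cos (t * X w + th) = cos (t * m + th) * expR (- (s ^+ 2 * t ^+ 2 / 2)).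
Proof.
pose f (x : R) := cos (t * x + th).
have bf : bmeas f by apply: bmeas_cosD; exact: measurable_funM.
have -> : \int[P]_w cos (t * X w + th) =
    fine (\int[pushforward P (X : T -> measurableTypeR R)]_x (f x)%:E).
  rewrite integral_pushforward// ?preimage_setT//.
    by apply/measurable_EFinP; case: bf.
  exact: (bmeas_integrable P (bmeas_comp bf mX)).
have [s0|s0] := eqVneq s 0.
  rewrite (eq_measure_integral (dirac (m : measurableTypeR R))) => [|A mA _]; last first.
    by have := lawX mA; rewrite /normal_law s0 eqxx.
  rewrite integral_dirac//; last by apply/measurable_EFinP; case: bf.
  by rewrite diracT mul1e /= s0 expr0n/= !mul0r oppr0 expR0 mulr1.
transitivity (\int[normal_prob m s]_x f x).
  congr fine; apply: eq_measure_integral => A mA _.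
  by have := lawX mA; rewrite /normal_law (negbTE s0).
rewrite (Rintegral_normal_prob m s bf) -(normal_pdf_charfun m s0).
by apply: eq_Rintegral => x _; rewrite /f; congr (cos _ * _); ring.
Qed.

Hypothesis iX : P.-integrable setT (EFin \o X).
Hypothesis iX2 : P.-integrable setT (EFin \o (fun w => X w ^+ 2)).
Hypothesis EX : \int[P]_w X w = 0.

(** The integral of n sin (X / n) tends to the mean of X by domination with |X|; the characteristic
    function evaluates it as n sin (m / n) exp (-s^2 / (2 n^2)), which tends to m. *)
Let m0 : m = 0.
Proof.
have cv1 : \int[P]_w (n.+1%:R * sin (X w / n.+1%:R)) @[n --> \oo] --> \int[P]_w X w.
  apply: (cvg_Rint_dom (g := fun w => `|X w|)).
  - move=> n; apply: measurable_funM => //.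
    apply: (measurableT_comp (continuous_measurable_fun (@continuous_sin R))).
    exact: measurable_funM.
  - exact: integrable_norm iX.
  - move=> n w; rewrite normrM ger0_norm// mulrC -ler_pdivlMr//.
    by rewrite (le_trans (ler_norm_sin _))// normf_div (@ger0_norm _ n.+1%:R).
  - move=> w; exact: cvg_sin_scale.
have cv2 : \int[P]_w (n.+1%:R * sin (X w / n.+1%:R)) @[n --> \oo] --> m * 1.
  rewrite (_ : (fun n => _) = (fun n => (n.+1%:R * sin (m / n.+1%:R)) *
      expR (- (s ^+ 2 / 2) * (n.+1%:R^-1 * n.+1%:R^-1)))); last first.
    apply/funext => n; rewrite RintZ; last first.
      have := bmeas_cosD (- (pi / 2)) (measurable_funM mX (@measurable_cst _ _ T R setT n.+1%:R^-1)).
      by under eq_fun do rewrite cosBpihalf.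
    rewrite -mulrA; congr (_ * _).
    under eq_Rintegral do rewrite -cosBpihalf mulrC.
    rewrite normal_law_charfun cosBpihalf mulrC [m / _]mulrC mulrC.
    by congr (_ * expR _); rewrite expr2; ring.
  apply: cvgM; first exact: cvg_sin_scale.
  rewrite -[X in _ --> X]expR0 -[X in expR X](mulr0 (- (s ^+ 2 / 2))).
  apply: continuous_cvg; first exact: continuous_expR.
  apply: cvgM; first exact: cvg_cst.
  by rewrite -[X in _ --> X](mulr0 0); apply: cvgM; exact: cvg_harmonic.
by have := cvg_unique _ cv1 cv2; rewrite EX mulr1 => <-.
Qed.

(** The same device with 2 n^2 (1 - cos (X / n)), dominated by X^2. *)
Lemma normal_law_var : \int[P]_w (X w ^+ 2) = s ^+ 2.
Proof.
have cv1 : \int[P]_w (2 * n.+1%:R ^+ 2 * (1 - cos (X w / n.+1%:R))) @[n --> \oo]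
    --> \int[P]_w (X w ^+ 2).
  apply: (cvg_Rint_dom (g := fun w => X w ^+ 2)).
  - move=> n; apply: measurable_funM => //; apply: measurable_funB => //.
    apply: (measurableT_comp (continuous_measurable_fun (@continuous_cos R))).
    exact: measurable_funM.
  - exact: iX2.
  - move=> n w; have /andP[c0 c1] := onem_cos_scale_bound (X w) n.
    by rewrite ger0_norm.
  - move=> w; exact: cvg_onem_cos_scale.
suff cv2 : \int[P]_w (2 * n.+1%:R ^+ 2 * (1 - cos (X w / n.+1%:R))) @[n --> \oo]
    --> s ^+ 2 by exact: (cvg_unique _ cv1 cv2).
rewrite (_ : (fun n => _) =
  (fun n => 2 * n.+1%:R ^+ 2 * (1 - expR (- (s ^+ 2 * n.+1%:R^-1 ^+ 2 / 2))))).
  exact: cvg_onem_exp_scale.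
apply/funext => n.
have bc : bmeas (fun w => cos (X w / n.+1%:R)).
  have := bmeas_cosD 0 (measurable_funM mX (@measurable_cst _ _ T R setT n.+1%:R^-1)).
  by under eq_fun do rewrite addr0.
rewrite RintZ; last by apply: bmeasB => //; exact: bmeas_cst.
rewrite RintB//; last exact: bmeas_cst.
rewrite Rint_cst; congr (_ * (_ - _)).
under eq_Rintegral do rewrite mulrC -[_ * _]addr0.
by rewrite normal_law_charfun m0 mulr0 addr0 cos0 mul1r.
Qed.

Lemma normal_law_centered_charfun th :
  \int[P]_w cos (X w + th) = cos th * expR (- (\int[P]_w (X w ^+ 2) / 2)).
Proof.
have := normal_law_charfun 1 th; rewrite m0 mulr0 add0r normal_law_var.
by rewrite expr1n mulr1 => <-; apply: eq_Rintegral => w _; rewrite mul1r.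
Qed.

End normal_law.

Lemma jointly_normal_gaussian d (T : measurableType d) (R : realType)
    (P : probability T R) (I : finType) (X : I -> {RV P >-> R})
    (K : I -> I -> R) :
  jointly_normal X -> (forall i, 'E_P[X i] = 0)%E ->
  (forall i j, 'E_P[X i \* X j] = (K i j)%:E)%E ->
  gaussian P (fun i w => X i w) (fun a => \sum_i \sum_j a i * a j * K i j).
Proof.
move=> jn EX EXX; split=> // a th.
(* Square integrability is contained in the hypothesis on products, because [K i i] is a real
   number. The other moments follow from |xy| <= x^2 + y^2 and |x| <= 1 + x^2. *)
have iX2 i : P.-integrable setT (EFin \o (fun w => X i w ^+ 2)).
  apply/integrableP; split.
    by apply/measurable_EFinP; exact: measurable_funX.
  have E := EXX i i; rewrite unlock in E.
  rewrite (_ : integral _ _ _ = (K i i)%:E) ?ltry// -E.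
  by apply: eq_integral => w _ /=; rewrite ger0_norm ?sqr_ge0// expr2.
have iXX i j : P.-integrable setT (EFin \o (fun w => X i w * X j w)).
  apply: (le_integrable _ _ _ (integrableD measurableT (iX2 i) (iX2 j))) => //.
    by apply/measurable_EFinP; exact: measurable_funM.
  move=> w _ /=; rewrite lee_fin (@ger0_norm _ (_ + _)) ?addr_ge0 ?sqr_ge0//.
  rewrite ler_norml; apply/andP; split; nra.
have iX i : P.-integrable setT (EFin \o (fun w => X i w)).
  have i1 : P.-integrable setT (EFin \o (fun w : T => 1 : R)).
    exact/bmeas_integrable/bmeas_cst.
  apply: (le_integrable _ _ _ (integrableD measurableT i1 (iX2 i))) => //.
    exact/measurable_EFinP.
  move=> w _ /=; rewrite lee_fin (@ger0_norm _ (_ + _)) ?addr_ge0 ?sqr_ge0//.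
  rewrite ler_norml; apply/andP; split; nra.
have [mu [s law]] := jn a.
have mY : measurable_fun setT (fun w => \sum_i a i * X i w).
  by apply: measurable_sum => i; exact: measurable_funM.
have iaX i := integrable_cM (a i) (iX i).
have [iY EY] := integrable_Rsum (index_enum I) iaX.
have Y2 w : (\sum_i a i * X i w) ^+ 2 =
    \sum_i \sum_j a i * a j * (X i w * X j w).
  rewrite expr2 mulr_suml; apply: eq_bigr => i _; rewrite mulr_sumr.
  by apply: eq_bigr => j _; ring.
have iaXX i j := integrable_cM (a i * a j) (iXX i j).
have iS i := (integrable_Rsum (index_enum I) (iaXX i)).1.
have ES i := (integrable_Rsum (index_enum I) (iaXX i)).2.
have [iY2 EY2] := integrable_Rsum (index_enum I) iS.
rewrite (normal_law_centered_charfun mY law iY).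
- congr (_ * expR (- (_ / 2))).
  under eq_Rintegral do rewrite Y2.
  rewrite EY2; apply: eq_bigr => i _; rewrite ES; apply: eq_bigr => j _.
  rewrite (RintegralZl _ measurableT (iXX i j)); congr (_ * _).
  by have := EXX i j; rewrite unlock /Rintegral => ->.
- by under [X in _.-integrable _ (EFin \o X)]eq_fun do rewrite Y2.
- rewrite EY big1// => i _; rewrite (RintegralZl _ measurableT (iX i)).
  by have := EX i; rewrite unlock /Rintegral => ->; rewrite mulr0.
Qed.

Section gaussian_combination.
Context d1 d2 (T1 : measurableType d1) (T2 : measurableType d2) (R : realType).
Variables (P1 : probability T1 R) (P2 : probability T2 R).
Variables (I J : finType) (X : I -> T1 -> R) (Y : J -> T2 -> R).
Variables (q1 : (I -> R) -> R) (q2 : (J -> R) -> R).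
Hypotheses (gX : gaussian P1 X q1) (gY : gaussian P2 Y q2).

Lemma gaussian_prod_charfun (a : I -> R) (b : J -> R) th :
  \int[prodP P1 P2]_z cos (\sum_i a i * X i z.1 + \sum_j b j * Y j z.2 + th) =
  cos th * expR (- ((q1 a + q2 b) / 2)).
Proof.
have [mX cX] := gX; have [mY cY] := gY.
have mXa : measurable_fun setT (fun z : T1 * T2 => \sum_i a i * X i z.1).
  apply: measurable_sum => i; apply: measurable_funM => //.
  exact: (measurableT_comp (mX i) measurable_fst).
have mYb : measurable_fun setT (fun z : T1 * T2 => \sum_j b j * Y j z.2).
  apply: measurable_sum => i; apply: measurable_funM => //.
  exact: (measurableT_comp (mY i) measurable_snd).
rewrite Rint_prod; last by apply: bmeas_cosD; exact: measurable_funD.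
under eq_Rintegral => x _.
  under eq_Rintegral do rewrite /= -addrA addrCA.
  rewrite cY; over.
under eq_Rintegral do rewrite mulrC.
rewrite RintZ; last first.
  apply: bmeas_cosD; apply: measurable_sum => i; exact: measurable_funM.
by rewrite cX mulrCA -expRD; congr (_ * expR _); ring.
Qed.

End gaussian_combination.

Section gaussian_moments.
Context d (T : measurableType d) (R : realType) (P : probability T R).
Variables (I : finType) (X : I -> T -> R) (q : (I -> R) -> R).
Hypothesis gX : gaussian P X q.

Let gaussian1 i t th :
  \int[P]_w cos (t * X i w + th) = cos th * expR (- (q (fun j => t * (j == i)%:R) / 2)).
Proof.
rewrite -gX.2; apply: eq_Rintegral => w _; congr (cos (_ + _)).
rewrite (bigD1 i)//= eqxx mulr1 big1 ?addr0// => j /negbTE ->.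
by rewrite mulr0 mul0r.
Qed.

(* Fatou's lemma applied to 2 n^2 (1 - cos (x / n)) --> x^2. *)
Lemma gaussian_sqr i v :
  (forall t, q (fun j => t * (j == i)%:R) = t ^+ 2 * v) ->
  P.-integrable setT (EFin \o (fun w => X i w ^+ 2)) /\
  \int[P]_w (X i w ^+ 2) <= v.
Proof.
move=> qi; have [mX _] := gX.
have bc (n : nat) : bmeas (fun w => cos (X i w / n.+1%:R)).
  have := bmeas_cosD 0 (measurable_funM (mX i) (@measurable_cst _ _ T R setT n.+1%:R^-1)).
  by under eq_fun do rewrite addr0.
pose f (n : nat) w := (2 * n.+1%:R ^+ 2 * (1 - cos (X i w / n.+1%:R)))%:E.
have bf (n : nat) : bmeas (fun w => 2 * n.+1%:R ^+ 2 * (1 - cos (X i w / n.+1%:R))).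
  by apply: bmeasZ; apply: bmeasB => //; exact: bmeas_cst.
have mf n : measurable_fun setT (f n) by apply/measurable_EFinP; case: (bf n).
have f0 n w : setT w -> (0 <= f n w)%E.
  by move=> _; rewrite lee_fin; case/andP: (onem_cos_scale_bound (X i w) n).
have If n : (\int[P]_w f n w)%E =
    (2 * n.+1%:R ^+ 2 * (1 - expR (- (v * n.+1%:R^-1 ^+ 2 / 2))))%:E.
  rewrite -[LHS]fineK; last exact: integrable_fin_num (bmeas_integrable P (bf n)).
  congr (_%:E); rewrite -/(Rintegral P setT _) RintZ; last first.
    by apply: bmeasB => //; exact: bmeas_cst.
  rewrite RintB//; last exact: bmeas_cst.
  rewrite Rint_cst; congr (_ * (_ - _)).
  under eq_Rintegral do rewrite mulrC -[_ * _]addr0.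
  by rewrite gaussian1 qi cos0 mul1r [v * _]mulrC.
have := fatou P measurableT mf f0.
have -> : (\int[P]_w limn_einf (f ^~ w) = \int[P]_w (X i w ^+ 2)%:E)%E.
  apply: eq_integral => w _; have cv : f n w @[n --> \oo] --> (X i w ^+ 2)%:E.
    by apply: cvg_EFin; [exact: nearW | exact: cvg_onem_cos_scale].
  by rewrite is_cvg_limn_einfE; [exact/cvg_lim | apply/cvg_ex; eexists; exact: cv].
have -> : limn_einf (fun n => \int[P]_w f n w)%E = v%:E.
  have cv : (\int[P]_w f n w)%E @[n --> \oo] --> v%:E.
    under eq_fun do rewrite If.
    by apply: cvg_EFin; [exact: nearW | exact: cvg_onem_exp_scale].
  by rewrite is_cvg_limn_einfE; [exact/cvg_lim | apply/cvg_ex; eexists; exact: cv].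
move=> le_v.
have iX : P.-integrable setT (EFin \o (fun w => X i w ^+ 2)).
  apply/integrableP; split; first by apply/measurable_EFinP; exact: measurable_funX.
  under eq_integral do rewrite /= ger0_norm ?sqr_ge0//.
  by rewrite (le_lt_trans le_v)// ltry.
split=> //; rewrite -lee_fin /Rintegral fineK//.
exact: integrable_fin_num iX.
Qed.

End gaussian_moments.

Section trig_polynomial.
Variables (R : realType) (I : finType).

(* The list of (c, a, th) encodes x |-> \sum c cos (a . x + th). *)
Definition trig := seq (R * (I -> R) * R).

Definition teval (F : trig) (x : I -> R) : R :=
  \sum_(p <- F) p.1.1 * cos (\sum_i p.1.2 i * x i + p.2).

(* The expectation of [teval F X] when X has characteristic function expR (- q / 2). *)
Definition tmean (q : (I -> R) -> R) (F : trig) : R :=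
  \sum_(p <- F) p.1.1 * (cos p.2 * expR (- (q p.1.2 / 2))).

(** The second partial derivative in the coordinates i and j: two derivatives turn a cosine into its
    opposite, so frequency and phase are kept. *)
Definition tderive2 (i j : I) (F : trig) : trig :=
  [seq (- (p.1.1 * p.1.2 i * p.1.2 j), p.1.2, p.2) | p <- F].

Lemma bmeas_teval d (T : measurableType d) (X : I -> T -> R) F :
  (forall i, measurable_fun setT (X i)) -> bmeas (fun w => teval F (X ^~ w)).
Proof.
move=> mX; apply: bmeas_sum => p; apply: bmeasZ; apply: bmeas_cosD.
by apply: measurable_sum => i; exact: measurable_funM.
Qed.

Lemma gaussian_teval d (T : measurableType d) (P : probability T R)
    (X : I -> T -> R) q F :
  gaussian P X q -> \int[P]_w teval F (X ^~ w) = tmean q F.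
Proof.
move=> [mX cX]; rewrite /teval Rint_sum => [|p]; last first.
  apply: bmeasZ; apply: bmeas_cosD.
  by apply: measurable_sum => i; exact: measurable_funM.
apply: eq_bigr => p _; rewrite RintZ ?cX//.
by apply: bmeas_cosD; apply: measurable_sum => i; exact: measurable_funM.
Qed.

Definition qform (K : I -> I -> R) (a : I -> R) : R :=
  \sum_i \sum_j a i * a j * K i j.

Lemma qformZ K t a : qform K (fun i => t * a i) = t ^+ 2 * qform K a.
Proof.
rewrite /qform mulr_sumr; apply: eq_bigr => i _.
by rewrite mulr_sumr; apply: eq_bigr => j _; ring.
Qed.

Lemma qform1 K t i : qform K (fun j => t * (j == i)%:R) = t ^+ 2 * K i i.
Proof.
have sum1 (f : I -> R) : \sum_j (j == i)%:R * f j = f i.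
  rewrite (bigD1 i)//= eqxx mul1r big1 ?addr0// => j /negbTE ->.
  by rewrite mul0r.
rewrite qformZ; congr (_ * _); rewrite /qform -[RHS](sum1 (K ^~ i)).
apply: eq_bigr => k _; rewrite -[in RHS](sum1 (K k)) mulr_sumr.
by apply: eq_bigr => j _; rewrite mulrA.
Qed.

Variables (A B : I -> I -> R).
Let mix t a := t * qform A a + (1 - t) * qform B a.

(** Gaussian interpolation formula. For trigonometric polynomials it only takes differentiating exp
    (-q / 2) term by term: the factor a_i a_j brought down is, up to sign, that of [tderive2]. *)
Lemma is_derive_tmean F (t : R) :
  is_derive t (1 : R) (fun t => tmean (mix t) F)
    (2^-1 * \sum_i \sum_j (A i j - B i j) * tmean (mix t) (tderive2 i j F)).
Proof.
have -> : 2^-1 * (\sum_i \sum_j (A i j - B i j) * tmean (mix t) (tderive2 i j F)) =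
  \sum_(p <- F) p.1.1 * (cos p.2 * (- ((qform A p.1.2 - qform B p.1.2) / 2)
    * expR (- (mix t p.1.2 / 2)))).
  under eq_bigr => i _.
    under eq_bigr do rewrite /tmean /tderive2 big_map mulr_sumr.
    rewrite exchange_big /=; over.
  rewrite exchange_big mulr_sumr; apply: eq_bigr => p _ /=.
  rewrite /qform -sumrB; under [in RHS]eq_bigr do rewrite -sumrB.
  set e := expR _; set S := (X in - (X / 2)).
  have -> : p.1.1 * (cos p.2 * (- (S / 2) * e)) = 2^-1 * (S * - (p.1.1 * (cos p.2 * e))).
    by field.
  congr (_ * _); rewrite /S mulr_suml; apply: eq_bigr => i _.
  by rewrite mulr_suml; apply: eq_bigr => j _; ring.
rewrite /tmean; elim: F => [|p F IH].
  under eq_fun do rewrite big_nil; rewrite big_nil.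
  exact: is_derive_cst.
under eq_fun do rewrite big_cons; rewrite big_cons.
apply: is_deriveD; rewrite /mix.
apply: is_derive_eq => /=.
by rewrite /GRing.scale/=; field.
Qed.

End trig_polynomial.

Section slepian_trig.
Context d1 d2 (T1 : measurableType d1) (T2 : measurableType d2) (R : realType).
Variables (P1 : probability T1 R) (P2 : probability T2 R) (I : finType).
Variables (V : I -> T1 -> R) (W : I -> T2 -> R) (A B : I -> I -> R).
Hypotheses (gV : gaussian P1 V (qform A)) (gW : gaussian P2 W (qform B)).
Hypothesis AB_diag : forall i, A i i = B i i.
Hypothesis AB_le : forall i j, i != j -> B i j <= A i j.

Let mix t a := t * qform A a + (1 - t) * qform B a.

(** It makes [tmean (mix t)] a true expectation, along which pointwise inequalities can be
    integrated. *)
Lemma gaussian_mix t : 0 <= t <= 1 ->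
  gaussian (prodP P1 P2)
    (fun i z => Num.sqrt t * V i z.1 + Num.sqrt (1 - t) * W i z.2) (mix t).
Proof.
move=> /andP[t0 t1]; split=> [i|a th].
  by apply: measurable_funD; apply: measurable_funM => //;
    [exact: (measurableT_comp (gV.1 i) measurable_fst)
    |exact: (measurableT_comp (gW.1 i) measurable_snd)].
have := gaussian_prod_charfun gV gW (fun i => Num.sqrt t * a i)
  (fun i => Num.sqrt (1 - t) * a i) th.
rewrite !qformZ !sqr_sqrtr// ?subr_ge0// => <-.
apply: eq_Rintegral => z _; congr (cos (_ + _)).
by rewrite -big_split /=; apply: eq_bigr => i _; ring.
Qed.

(** In the interpolation formula the diagonal terms vanish and the others have nonnegative weights.
    The quadratic defect has bounded expectation, since (x - a)^2 <= 2 (x^2 + a^2) and the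
    interpolated variances stay equal to [A k k]. *)
Lemma slepian_trig (F : trig R I) (a : I -> R) (eps : R) :
  (forall i j x, i != j ->
     - (eps * \sum_k (x k - a k) ^+ 2) <= teval (tderive2 i j F) x) ->
  0 <= eps ->
  tmean (qform B) F - eps * (2^-1 * (\sum_i \sum_j (A i j - B i j)) *
    \sum_k (2 * (A k k + a k ^+ 2))) <= tmean (qform A) F.
Proof.
move=> F2 eps0; set S := \sum_k (2 * _); set D := \sum_i _.
pose g t := tmean (mix t) F.
pose dg t := 2^-1 * \sum_i \sum_j (A i j - B i j) * tmean (mix t) (tderive2 i j F).
have dgP (t : R) : is_derive t (1 : R) g (dg t) by exact: is_derive_tmean.
have cg : {within `[0, 1], continuous g}.
  apply: continuous_subspaceT => t.
  exact/differentiable_continuous/derivable1_diffP/ex_derive.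
have [c c01 E] := MVT ltr01 (fun t _ => dgP t) cg.
have -> : tmean (qform A) F = g 1.
  by congr tmean; apply/funext => b; rewrite /mix mul1r subrr mul0r addr0.
have -> : tmean (qform B) F = g 0.
  by congr tmean; apply/funext => b; rewrite /mix mul0r subr0 mul1r add0r.
suff dgc : - (eps * (2^-1 * D * S)) <= dg c by move: E; rewrite subr0 mulr1; lra.
have {}c01 : 0 <= c <= 1.
  by move: c01; rewrite in_itv/= => /andP[c0 c1]; rewrite !ltW.
have gX := gaussian_mix c01; set X := (X in gaussian _ X _) in gX.
have Dge i j : i != j -> - (eps * S) <= tmean (mix c) (tderive2 i j F).
  move=> ij; rewrite -(gaussian_teval _ gX).
  have sq k := gaussian_sqr (i := k) (v := A k k) gX.
  have iX k : (prodP P1 P2).-integrable setT (EFin \o (fun w => X k w ^+ 2)) /\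
      \int[prodP P1 P2]_w (X k w ^+ 2) <= A k k.
    apply: sq => t; by rewrite /mix !qform1 -AB_diag; ring.
  pose h w := \sum_k (eps * 2) * (X k w ^+ 2 + a k ^+ 2).
  have ik k : (prodP P1 P2).-integrable setT
      (EFin \o (fun w => X k w ^+ 2 + a k ^+ 2)).
    have ic := bmeas_integrable (prodP P1 P2) (@bmeas_cst _ (T1 * T2)%type _ (a k ^+ 2)).
    exact: (integrableD measurableT (iX k).1 ic).
  have [ih Eh] := integrable_Rsum (index_enum I) (fun k => integrable_cM (eps * 2) (ik k)).
  have itF := bmeas_integrable (prodP P1 P2) (bmeas_teval (tderive2 i j F) gX.1).
  have hS : \int[prodP P1 P2]_w h w <= eps * S.
    rewrite Eh mulr_sumr; apply: ler_sum => k _.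
    rewrite (RintegralZl _ measurableT (ik k)) -mulrA ler_wpM2l// ler_wpM2l//.
    have ic := bmeas_integrable (prodP P1 P2) (@bmeas_cst _ (T1 * T2)%type _ (a k ^+ 2)).
    by rewrite (RintegralD measurableT (iX k).1 ic) Rint_cst lerD2r (iX k).2.
  have : 0 <= \int[prodP P1 P2]_w (teval (tderive2 i j F) (X ^~ w) + h w).
    apply: Rintegral_ge0 => w _; have := F2 i j (X ^~ w) ij.
    suff : eps * \sum_k (X k w - a k) ^+ 2 <= h w by lra.
    rewrite /h mulr_sumr; apply: ler_sum => k _; rewrite -mulrA ler_wpM2l//.
    by have := sqr_ge0 (X k w + a k); nra.
  rewrite (RintegralD measurableT itF ih) -lerBlDr sub0r.
  by apply: le_trans; rewrite lerN2.
have Dsum : - (eps * S) * D <= \sum_i \sum_j (A i j - B i j) * tmean (mix c) (tderive2 i j F).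
  rewrite mulr_sumr; apply: ler_sum => i _; rewrite mulr_sumr; apply: ler_sum => j _.
  have [->|ij] := eqVneq i j; first by rewrite AB_diag subrr mulr0 mul0r.
  by rewrite mulrC ler_wpM2l ?Dge// subr_ge0 AB_le.
rewrite /dg; move: Dsum; set Q := \sum_i _; lra.
Qed.

End slepian_trig.

(** * Trigonometric approximation of indicator functions *)

Section step_function.
Variable R : realType.
Implicit Types x y q z k a : R.

(** It cancels the factor 2^n in the derivative of [phi]. *)
Lemma exprn_onem_bound q n : 0 <= q <= 1 -> (1 - q) ^+ n * (1 + n%:R * q) <= 1.
Proof.
move=> /andP[q0 q1]; elim: n => [|n IH]; first by rewrite expr0 mul0r addr0 mul1r.
apply: le_trans IH; rewrite exprSr -mulrA ler_wpM2l ?exprn_ge0 ?subr_ge0//.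
by rewrite -natr1; have := ler0n R n; move: (n%:R) => m m0; nra.
Qed.

Definition phi_z k a x : R := (1 + sin (k * (x - a))) / 2.

(** The power (1 - z^n)^(2^n), familiar from elementary proofs of the Stone-Weierstrass theorem,
    drops from near 1 to near 0 as z crosses 1/2, the value of [phi_z] at x = a. Being polynomial in
    z, it stays trigonometric in x. *)
Definition phi n k a x : R := (1 - phi_z k a x ^+ n) ^+ (2 ^ n)%N.

Definition dphi n k a x : R :=
  - ((2 ^ n)%N%:R * (1 - phi_z k a x ^+ n) ^+ (2 ^ n).-1 *
     (n%:R * phi_z k a x ^+ n.-1) * (k * cos (k * (x - a)) / 2)).

Lemma phi_z01 k a x : 0 <= phi_z k a x <= 1.
Proof.
by rewrite /phi_z; have := sin_geN1 (k * (x - a)); have := sin_le1 (k * (x - a)); lra.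
Qed.

Lemma phi01 n k a x : 0 <= phi n k a x <= 1.
Proof.
have /andP[z0 z1] := phi_z01 k a x.
have q1 := exprn_ile1 n z0 z1; have q0 : 0 <= phi_z k a x ^+ n by rewrite exprn_ge0.
rewrite /phi exprn_ge0 ?subr_ge0//= exprn_ile1 ?subr_ge0//; lra.
Qed.

Lemma is_derive_phi n k a x : (0 < n)%N ->
  is_derive (x : R) (1 : R) (phi n k a) (dphi n k a x).
Proof.
case: n => // n _.
have dz : is_derive (x : R) (1 : R) (phi_z k a) (k * cos (k * (x - a)) / 2).
  rewrite /phi_z; apply: is_derive_eq => /=.
  by rewrite /GRing.scale/=; field.
have dq := is_deriveX n.+1 dz; rewrite exprfctE in dq.
have d1 : is_derive (x : R) (1 : R) (fun y => 1 - phi_z k a y ^+ n.+1)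
    (- ((n.+1%:R * phi_z k a x ^+ n) * (k * cos (k * (x - a)) / 2))).
  by apply: is_derive_eq; rewrite /GRing.scale/=; ring.
have := is_deriveX (2 ^ n.+1)%N d1; rewrite exprfctE => dX.
by apply: is_derive_eq; rewrite /dphi /GRing.scale/=; ring.
Qed.

Lemma dphi_le n k a x : (0 < n)%N -> 0 <= k -> `|dphi n k a x| <= 2 * n%:R * k.
Proof.
case: n => // n _ k0; rewrite /dphi normrN normrM.
have -> : 2 * n.+1%:R * k = 4 * n.+1%:R * (k / 2) by field.
apply: ler_pM => //; last first.
  rewrite normrM normrM (ger0_norm k0) (@ger0_norm _ 2^-1)// ler_wpM2r//.
  by rewrite ler_piMr// cos_max.
have /andP[] := phi_z01 k a x; move: (phi_z k a x) => z z0 z1.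
have q1 := exprn_ile1 n.+1 z0 z1.
have q0 : 0 <= z ^+ n.+1 by rewrite exprn_ge0.
have e0 m : 0 <= (1 - z ^+ n.+1) ^+ m by rewrite exprn_ge0 ?subr_ge0.
rewrite ger0_norm; last by rewrite !mulr_ge0 ?exprn_ge0 ?e0 ?subr_ge0.
set K := (2 ^ n.+1).-1.
have E : (2 ^ n.+1)%N = K.+1 by rewrite prednK ?expn_gt0.
move: K E => K E /=.
(* Any cut strictly between 0 and 1/2 separates the regimes. Above it, dividing the bound for
   z^(n+1) by z costs the factor 4; below it, 2^(n+1) z^n = 2 (2z)^n <= 2. *)
have [z4|z4] := leP 4^-1 z.
  have B : K.+1%:R * (1 - z ^+ n.+1) ^+ K * z ^+ n.+1 <= 1.
    have := @exprn_onem_bound (z ^+ n.+1) K; rewrite q0 q1 => /(_ isT).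
    apply: le_trans; rewrite mulrAC mulrC ler_wpM2l ?e0//.
    by rewrite -natr1; nra.
  have z_gt0 : 0 < z by apply: lt_le_trans z4; rewrite invr_gt0.
  rewrite E -(ler_pM2r z_gt0).
  rewrite [leLHS](_ : _ = n.+1%:R * (K.+1%:R * (1 - z ^+ n.+1) ^+ K * z ^+ n.+1)).
    apply: (@le_trans _ _ (n.+1%:R * 1)); first by rewrite ler_wpM2l.
    by rewrite mulr1 mulrAC ler_peMl//; lra.
  by rewrite exprS; ring.
have -> : (2 ^ n.+1)%N%:R * (1 - z ^+ n.+1) ^+ K * (n.+1%:R * z ^+ n) =
    n.+1%:R * (2 * ((2 * z) ^+ n * (1 - z ^+ n.+1) ^+ K)).
  by rewrite natrX exprS exprMn; ring.
rewrite [leRHS]mulrC ler_wpM2l//.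
have z20 : 0 <= (2 * z) ^+ n by rewrite exprn_ge0 ?mulr_ge0.
have z21 : (2 * z) ^+ n <= 1 by rewrite exprn_ile1 ?mulr_ge0//; lra.
have e1 : (1 - z ^+ n.+1) ^+ K <= 1 by rewrite exprn_ile1 ?subr_ge0//; lra.
by have := e0 K; nra.
Qed.

(** The sine is increasing on |k (x - a)| <= 1 <= pi/2, hence the profile decreases there. *)
Lemma dphi_le0 n k a x : 0 <= k -> (k * (x - a)) ^+ 2 <= 1 -> dphi n k a x <= 0.
Proof.
move=> k0 kx; rewrite /dphi oppr_le0.
have /andP[z0 z1] := phi_z01 k a x.
have q1 := exprn_ile1 n z0 z1.
rewrite !mulr_ge0 ?exprn_ge0 ?subr_ge0 ?invr_ge0//.
have kx1 : `|k * (x - a)| <= 1 by rewrite -(@ler_pXn2r _ 2)// ?nnegrE// expr1n real_normK ?num_real.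
apply: cos_ge0_pihalf; have := pihalf_ge1 R; move: kx1; rewrite ler_norml; lra.
Qed.

(** Bernoulli's inequality (1 - q)^K >= 1 - K q with K = 2^n and q = z^n, so that K q = (2z)^n. *)
Lemma phi_ge n k a x : 1 - (1 + sin (k * (x - a))) ^+ n <= phi n k a x.
Proof.
have /andP[z0 z1] := phi_z01 k a x.
have -> : 1 + sin (k * (x - a)) = 2 * phi_z k a x by rewrite /phi_z; field.
rewrite /phi; move: (phi_z k a x) z0 z1 => z z0 z1.
have q1 := exprn_ile1 n z0 z1.
have q0 : 0 <= z ^+ n by rewrite exprn_ge0.
rewrite exprMn -natrX; move: (2 ^ n)%N (z ^+ n) q0 q1 => K q q0 q1.
elim: K => [|K IH]; first by rewrite mul0r subr0 expr0.
rewrite exprS -natr1; apply: (@le_trans _ _ ((1 - q) * (1 - K%:R * q))).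
  by have := ler0n R K; move: (K%:R) => m m0; nra.
by rewrite ler_wpM2l// subr_ge0.
Qed.

Lemma phi_le n k a x : phi n k a x <= expR (- (1 + sin (k * (x - a))) ^+ n).
Proof.
have /andP[z0 z1] := phi_z01 k a x.
have -> : 1 + sin (k * (x - a)) = 2 * phi_z k a x by rewrite /phi_z; field.
rewrite /phi; move: (phi_z k a x) z0 z1 => z z0 z1.
have q1 := exprn_ile1 n z0 z1.
rewrite exprMn -natrX -mulrN expRM_natl.
rewrite lerXn2r ?nnegrE ?subr_ge0 ?expR_ge0//.
exact: expR_ge1Dx.
Qed.

Lemma exprn_ge1Dnx (x : R) n : -1 <= x -> 1 + n%:R * x <= (1 + x) ^+ n.
Proof.
move=> x1; elim: n => [|n IH]; first by rewrite mul0r addr0 expr0.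
rewrite exprS -natr1; apply: (@le_trans _ _ ((1 + x) * (1 + n%:R * x))).
  by have := ler0n R n; move: (n%:R) => m m0; nra.
by rewrite ler_wpM2l//; lra.
Qed.

Lemma sin_ge_lin y : 0 <= y <= 1 -> cos 1 * y <= sin y.
Proof.
move=> /andP[y0 y1]; have [c cy ->] := sin_mvt y.
rewrite mulrC ler_wpM2l// -(cos_norm c).
have c1 : `|c| <= 1 by rewrite (le_trans cy)// ger0_norm.
have pi2 := pi_ge2 R.
have [->//|c_neq1] := eqVneq `|c| 1.
rewrite ltW// ltr_cos ?in_itv/= ?normr_ge0//; try lra.
Qed.

(* The frequency tends to 0 and the centre tends to a, both slowly enough for
   the transition to happen on a scale that shrinks to the left of a. *)
Definition step (l : nat) (a : R) : R -> R :=
  phi (l.+1 ^ 5) (l.+1%:R ^- 3) (a - l.+1%:R^-1).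

(** At x = a the limit is 0 because the centres lie to the left of a by 1/L; this is why the events
    below are strict. *)
Lemma cvg_step a x : step l a x @[l --> \oo] --> ((x < a)%R%:R : R).
Proof.
set C : R := cos 1; have C0 : 0 < C := cos1_gt0 R.
(* On either side the error is at most exp (-L v), with v = C (a - x) / 2 or v = C, and exp (-L v)
   <= 1 / (L v). Here C = cos 1 is the slope in [sin_ge_lin]. *)
pose D : R := if x < a then ((a - x) / 2 * C)^-1 else C^-1.
suff near_step : \forall l \near \oo, `|(x < a)%R%:R - step l a x| <= D / l.+1%:R.
  apply/cvgrPdist_le => e e0; near=> l.
  apply: (@le_trans _ _ (D / l.+1%:R)); first by near: l.
  rewrite ler_pdivrMr// mulrC -ler_pdivrMr//.
  have : D / e <= l%:R by near: l; exact: nbhs_infty_ger.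
  by rewrite -natr1; lra.
near=> l; set L : R := l.+1%:R.
have L1 : 1 <= L by rewrite /L ler1n.
have L0 : 0 < L by exact: lt_le_trans L1.
have L3 : 0 <= L ^- 3 by rewrite invr_ge0 exprn_ge0 ?(ltW L0).
set y := x - (a - L^-1).
(* The argument of the sine eventually lies where the linear lower bound applies. *)
have yL : `|L ^- 3 * y| <= 1.
  have xL : `|x - a| + 1 <= L.
    rewrite /L -natr1 lerD2r; near: l; exact: nbhs_infty_ger.
  have y1 : `|y| <= L.
    rewrite (_ : y = (x - a) + L^-1); last by rewrite /y; ring.
    rewrite (le_trans (ler_normD _ _))// (le_trans _ xL)// lerD2l.
    by rewrite ger0_norm ?invr_ge0 ?(ltW L0)// invf_le1.
  rewrite normrM ger0_norm ?invr_ge0 ?exprn_ge0 ?(ltW L0)//.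
  rewrite mulrC ler_pdivrMr ?exprn_gt0// mul1r (le_trans y1)//.
  by rewrite ler_eXnr.
have nL : (l.+1 ^ 5)%N%:R = L ^+ 5 :> R by rewrite natrX.
rewrite /step -/L; set n := (l.+1 ^ 5)%N in nL *.
have [xa|ax] := ltP x a.
  set e := (a - x) / 2; have e0 : 0 < e by rewrite divr_gt0// subr_gt0.
  have eL : L^-1 <= e.
    rewrite -[leRHS]invrK lef_pV2 ?posrE ?invr_gt0//.
    rewrite /L; apply: (@le_trans _ _ l%:R); last by rewrite ler_nat.
    near: l; exact: nbhs_infty_ger.
  have ye : y <= - e by move: eL; rewrite /y /e; move: (L^-1) => i; lra.
  have sy : sin (L ^- 3 * y) <= - (L ^- 3 * (C * e)).
    rewrite -[sin _]opprK -sinN lerN2 (le_trans _ (sin_ge_lin _))//.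
      rewrite -/C (_ : C * - _ = L ^- 3 * (C * - y)); last by ring.
      by rewrite ler_wpM2l// ler_wpM2l ?(ltW C0)//; lra.
    rewrite -mulrN mulr_ge0//=; last lra.
    by rewrite (le_trans (ler_norm _))// mulrN normrN.
  have /andP[_ p1] := phi01 n (L ^- 3) (a - L^-1) x.
  rewrite ger0_norm ?subr_ge0// lerBlDr -lerBlDl.
  apply: le_trans (phi_ge _ _ _ _); rewrite lerD2l lerN2 -/y.
  have s1 : 0 <= 1 + sin (L ^- 3 * y) by have := sin_geN1 (L ^- 3 * y); lra.
  apply: (@le_trans _ _ (expR (n%:R * sin (L ^- 3 * y)))).
    rewrite expRM_natl lerXn2r ?nnegrE ?expR_ge0//; exact: expR_ge1Dx.
  apply: (@le_trans _ _ (expR (- (L * (C * e))))).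
    rewrite ler_expR nL (le_trans (ler_wpM2l _ sy)) ?exprn_ge0 ?(ltW L0)//.
    rewrite mulrN lerN2 (_ : L ^+ 5 * _ = L * L * (C * e)); last by field; rewrite gt_eqF.
    have Ce : 0 <= C * e by rewrite mulr_ge0 ?(ltW C0) ?(ltW e0).
    have LL : L <= L * L by rewrite -[leLHS]mulr1 ler_wpM2l ?(ltW L0).
    exact: ler_wpM2r.
  rewrite /D xa -/e expRN -invfM lef_pV2 ?posrE ?expR_gt0 ?mulr_gt0 ?subr_gt0//.
  by rewrite (le_trans _ (expR_ge1Dx _))// mulrC (mulrC e); lra.
have yL1 : L^-1 <= y by rewrite /y; move: (L^-1) => i; lra.
have sy : L ^- 3 * (C * L^-1) <= sin (L ^- 3 * y).
  rewrite (le_trans _ (sin_ge_lin _))//.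
    by rewrite mulrCA -/C ler_wpM2l ?ler_wpM2l ?(ltW C0).
  rewrite mulr_ge0//=.
    by rewrite (le_trans (ler_norm _)).
  by rewrite (le_trans _ yL1)// invr_ge0 ltW.
have /andP[p0 _] := phi01 n (L ^- 3) (a - L^-1) x.
rewrite sub0r normrN ger0_norm//.
apply: le_trans (phi_le _ _ _ _) _; rewrite -/y.
have DE : D = C^-1 by rewrite /D ltNge ax.
rewrite DE expRN -invfM lef_pV2 ?posrE ?expR_gt0 ?mulr_gt0//.
rewrite (le_trans _ (expR_ge1Dx _))// (le_trans _ (ler_wpDl _ (exprn_ge1Dnx _ (sin_geN1 _))))//.
rewrite nL -lerBlDl (le_trans _ (ler_wpM2l _ sy)) ?exprn_ge0 ?(ltW L0)//.
rewrite (_ : L ^+ 5 * _ = L * C); last by field; rewrite gt_eqF.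
by rewrite (mulrC C); lra.
Unshelve. all: by end_near. Qed.

End step_function.

Section trig_class.
Variables (R : realType) (I : finType).
Implicit Types (F G : trig R I) (f g : (I -> R) -> R).

Definition is_trig f := exists F, teval F = f.

Lemma is_trig_cst c : is_trig (fun=> c).
Proof.
exists [:: (c, fun=> 0, 0)]; apply/funext => x.
by rewrite /teval big_seq1 /= big1 => [|i _]; rewrite ?mul0r// addr0 cos0 mulr1.
Qed.

Lemma is_trigD f g : is_trig f -> is_trig g -> is_trig (fun x => f x + g x).
Proof.
move=> [F <-] [G <-]; exists (F ++ G); apply/funext => x.
by rewrite /teval big_cat.
Qed.

(** Termwise product-to-sum formula: cos u cos v = (cos (u + v) + cos (u - v)) / 2. *)
Lemma is_trigM f g : is_trig f -> is_trig g -> is_trig (fun x => f x * g x).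
Proof.
move=> [F <-] [G <-]; elim: F => [|[[c a] s] F IH].
  have := is_trig_cst 0; congr is_trig; apply/funext => x.
  by rewrite /teval big_nil mul0r.
rewrite (_ : (fun x => _) = (fun x => c * cos (\sum_i a i * x i + s) * teval G x +
    teval F x * teval G x)); last first.
  by apply/funext => x; rewrite {1}/teval big_cons mulrDl.
apply: is_trigD IH; elim: G => [|[[c' a'] s'] G IHG].
  have := is_trig_cst 0; congr is_trig; apply/funext => x.
  by rewrite /teval big_nil mulr0.
rewrite (_ : (fun x => _) = (fun x => teval
    [:: (c * c' / 2, fun i => a i + a' i, s + s');
        (c * c' / 2, fun i => a i - a' i, s - s')] x +
    c * cos (\sum_i a i * x i + s) * teval G x)).
  by apply: is_trigD IHG; eexists.
apply/funext => x; rewrite /teval !big_cons big_nil mulrDr; congr (_ + _) => /=.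
rewrite addr0.
under [in RHS]eq_bigr do rewrite mulrDl.
under [X in _ + _ * cos (X + _)]eq_bigr do rewrite mulrBl.
rewrite big_split sumrB /=; set u := \sum_i a i * _; set v := \sum_i a' i * _.
rewrite (_ : u + v + (s + s') = (u + s) + (v + s')); last by ring.
rewrite (_ : u - v + (s - s') = (u + s) - (v + s')); last by ring.
by rewrite (cosD (u + s)) (cosB (u + s)); field.
Qed.

Lemma is_trigX f n : is_trig f -> is_trig (fun x => f x ^+ n).
Proof.
move=> tf; elim: n => [|n IH].
  by have := is_trig_cst 1; congr is_trig; apply/funext => x; rewrite expr0.
have := is_trigM tf IH; congr is_trig; apply/funext => x; by rewrite exprS.
Qed.

Lemma is_trig_prod (r : seq I) (f : I -> (I -> R) -> R) :
  (forall i, is_trig (f i)) -> is_trig (fun x => \prod_(i <- r) f i x).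
Proof.
move=> tf; elim: r => [|i r IH].
  by have := is_trig_cst 1; congr is_trig; apply/funext => x; rewrite big_nil.
have := is_trigM (tf i) IH; congr is_trig; apply/funext => x; by rewrite big_cons.
Qed.

Lemma is_trig_phi n k c i : is_trig (fun x => phi n k c (x i)).
Proof.
have ts : is_trig (fun x => sin (k * (x i - c))).
  exists [:: (1, fun j => k * (j == i)%:R, - (k * c) - pi / 2)].
  apply/funext => x; rewrite /teval big_seq1 /= mul1r addrA cosBpihalf.
  congr sin; rewrite (bigD1 i)//= eqxx big1 ?addr0 ?mulr1 ?mulrBr//.
  by move=> j /negbTE ->; rewrite mulr0 mul0r.
have tz : is_trig (fun x => phi_z k c (x i)).
  have := is_trigM (is_trigD (is_trig_cst 1) ts) (is_trig_cst 2^-1).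
  by congr is_trig.
apply: is_trigX; have := is_trigD (is_trig_cst 1) (is_trigM (is_trig_cst (-1)) (is_trigX n tz)).
by congr is_trig; apply/funext => x; rewrite mulN1r.
Qed.

Definition update (x : I -> R) i s : I -> R := fun k => if k == i then s else x k.

Lemma update_id x i : update x i (x i) = x.
Proof. by apply/funext => k; rewrite /update; case: eqP => [->|]. Qed.

(** The derivative of cos is cos (. + pi/2), so a derivative is again in the encoding. *)
Definition tderive i F : trig R I :=
  [seq (p.1.1 * p.1.2 i, p.1.2, p.2 + pi / 2) | p <- F].

Lemma is_derive_teval F x i (s : R) :
  is_derive s (1 : R) (fun s => teval F (update x i s))
    (teval (tderive i F) (update x i s)).
Proof.
rewrite /tderive /teval big_map; elim: F => [|[[c a] th] F IH].
  under eq_fun do rewrite big_nil; rewrite big_nil; exact: is_derive_cst.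
under eq_fun do rewrite big_cons; rewrite big_cons; apply: is_deriveD => /=.
have E t : \sum_k a k * update x i t k = a i * t + \sum_(k | k != i) a k * x k.
  rewrite (bigD1 i)//= /update eqxx; congr (_ + _).
  by apply: eq_bigr => k /negbTE ->.
under eq_fun do rewrite E.
rewrite E addrA cosDpihalf; apply: is_derive_eq => /=.
by rewrite /GRing.scale/=; ring.
Qed.

(** The coefficients of F are unknown when F comes from [is_trig]; uniqueness of derivatives
    computes its formal derivative from its values. *)
Lemma tderive_partial F g g' i : (forall x, teval F x = g x) ->
  (forall x, is_derive (x i : R) (1 : R) (fun s => g (update x i s)) (g' x)) ->
  forall x, teval (tderive i F) x = g' x.
Proof.
move=> Fg dg x; have d1 := is_derive_teval F x i (x i).
rewrite update_id in d1.
rewrite -(derive_val (is_derive := d1)) -(derive_val (is_derive := dg x)).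
by congr derive; apply/funext => s.
Qed.

Lemma tderiveE i j F x : teval (tderive j (tderive i F)) x = teval (tderive2 i j F) x.
Proof.
rewrite /tderive /tderive2 /teval !big_map; apply: eq_bigr => p _ /=.
rewrite !addrA cosDpihalf sinDpihalf; ring.
Qed.

Lemma tderive2_prod F (f df : I -> R -> R) i j :
  (forall x, teval F x = \prod_k f k (x k)) ->
  (forall k (s : R), is_derive s (1 : R) (f k) (df k s)) ->
  i != j ->
  forall x, teval (tderive2 i j F) x =
    df i (x i) * df j (x j) * \prod_(k | (k != i) && (k != j)) f k (x k).
Proof.
move=> Ff dff ij x; rewrite -tderiveE.
have step1 : forall x, teval (tderive i F) x = df i (x i) * \prod_(k | k != i) f k (x k).
  apply: tderive_partial Ff _ => y.
  under eq_fun => s.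
    rewrite (bigD1 i)//= {1}/update eqxx (eq_bigr (fun k => f k (y k))).
      over.
    by move=> k /negbTE ki; rewrite /update ki.
  have := dff i (y i) => d1; apply: is_derive_eq.
  by rewrite /GRing.scale/=; ring.
move: x; apply: tderive_partial step1 _ => y.
under eq_fun => s.
  rewrite (bigD1 j) 1?eq_sym//= {1 2}/update eqxx (negbTE ij).
  rewrite (eq_bigr (fun k => f k (y k))).
    over.
  by move=> k /andP[_ /negbTE kj]; rewrite /update kj.
have := dff j (y j) => d1; apply: is_derive_eq.
by rewrite /GRing.scale/=; ring.
Qed.

End trig_class.

(** * Slepian's inequality *)

Lemma cvg_bigprod (R : realType) (I : Type) (r : seq I) (f : I -> nat -> R) (l : I -> R) :
  (forall i, f i n @[n --> \oo] --> l i) ->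
  \prod_(i <- r) f i n @[n --> \oo] --> \prod_(i <- r) l i.
Proof.
move=> fl; elim: r => [|i r IH].
  by under eq_fun do rewrite big_nil; rewrite big_nil; exact: cvg_cst.
by under eq_fun do rewrite big_cons; rewrite big_cons; exact: cvgM.
Qed.

Section slepian.
Variables (R : realType) (I : finType) (a : I -> R).

Definition below d (T : measurableType d) (X : I -> T -> R) : set T :=
  [set w | forall i, X i w < a i].

Lemma measurable_below d (T : measurableType d) (X : I -> T -> R) :
  (forall i, measurable_fun setT (X i)) -> measurable (below X).
Proof.
move=> mX; rewrite (_ : below X = \bigcap_(i in [set: I]) (X i @^-1` `]-oo, a i[)).
  apply: fin_bigcap_measurable => [|i _]; first exact: finite_finset.
  by rewrite -[_ @^-1` _]setTI; apply: mX.
apply/seteqP; split => w /= Xa i; first by move=> _; rewrite /= in_itv/=; exact: Xa.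
by have := Xa i Logic.I; rewrite /= in_itv/=.
Qed.

Lemma below_indic d (T : measurableType d) (X : I -> T -> R) w :
  \1_(below X) w = \prod_i (X i w < a i)%R%:R :> R.
Proof.
rewrite indicE; have [/set_mem Xa|Xa] := boolP (w \in below X).
  by rewrite big1// => i _; rewrite Xa.
have [i Xi] : exists i, ~~ (X i w < a i).
  apply/not_existsP => H; move/negP: Xa; apply; apply/mem_set => i.
  by apply/negPn/negP; exact: H.
by rewrite (bigD1 i)//= (negbTE Xi) mul0r.
Qed.

Lemma measurable_step l c : measurable_fun setT (step l c : R -> R).
Proof.
apply: continuous_measurable_fun => x.
apply/differentiable_continuous/derivable1_diffP.
have := @is_derive_phi R (l.+1 ^ 5) (l.+1%:R ^- 3) (c - l.+1%:R^-1) x.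
by rewrite expn_gt0 => /(_ isT) ?; exact: ex_derive.
Qed.

Lemma cvg_Rint_step d (T : measurableType d) (P : probability T R) (X : I -> T -> R) :
  (forall i, measurable_fun setT (X i)) ->
  \int[P]_w (\prod_i step l (a i) (X i w)) @[l --> \oo] --> fine (P (below X)).
Proof.
move=> mX; rewrite -Rint_indic; last exact: measurable_below.
apply: (cvg_Rint (M := 1)).
- move=> l; apply: measurable_prod => i _.
  exact: (measurableT_comp (measurable_step l (a i)) (mX i)).
- move=> l w; rewrite ger0_norm; last first.
    by apply: prodr_ge0 => i _; case/andP: (phi01 (l.+1 ^ 5) (l.+1%:R ^- 3) (a i - l.+1%:R^-1) (X i w)).
  apply: prodr_ile1 => i _; exact: phi01.
- move=> w; rewrite below_indic.
  by apply: cvg_bigprod => i; exact: cvg_step.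
Qed.

(** The inequality is shown for the products of [step l] with an error 4 M / L, and l tends to
    infinity. *)
Lemma slepian d1 d2 (T1 : measurableType d1) (T2 : measurableType d2)
    (P1 : probability T1 R) (P2 : probability T2 R)
    (V : I -> T1 -> R) (W : I -> T2 -> R) (A B : I -> I -> R) :
  gaussian P1 V (qform A) -> gaussian P2 W (qform B) ->
  (forall i, A i i = B i i) -> (forall i j, i != j -> B i j <= A i j) ->
  fine (P2 (below W)) <= fine (P1 (below V)).
Proof.
move=> gV gW AB_diag AB_le.
set D := 2^-1 * (\sum_i \sum_j (A i j - B i j)).
have A0 i : 0 <= A i i.
  have [_ ] := gaussian_sqr (i := i) (v := A i i) gV (fun t => qform1 A t i).
  by apply: le_trans; apply: Rintegral_ge0 => w _; exact: sqr_ge0.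
have D0 : 0 <= D.
  rewrite mulr_ge0// sumr_ge0// => i _; rewrite sumr_ge0// => j _; rewrite subr_ge0.
  by have [->|] := eqVneq i j; [rewrite AB_diag | exact: AB_le].
(* A bound independent of l: the moving centres satisfy (a - 1/L)^2 <= 2 (a^2 + 1). *)
set M := D * \sum_k 2 * (A k k + 2 * (a k ^+ 2 + 1)).
have M0 : 0 <= M.
  rewrite mulr_ge0// sumr_ge0// => k _.
  by have := sqr_ge0 (a k); have := A0 k; nra.
have cW := @cvg_Rint_step _ _ P2 W gW.1; have cV := @cvg_Rint_step _ _ P1 V gV.1.
have c0 : 4 * M * harmonic l @[l --> \oo] --> (4 * M * 0 : R).
  by apply: cvgM; [exact: cvg_cst | exact: cvg_harmonic].
rewrite -[leLHS]subr0 -(mulr0 (4 * M)); apply: ler_cvg_to (cvgB cW c0) cV _.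
apply: nearW => l; set L : R := l.+1%:R.
rewrite [leLHS](_ : _ = \int[P2]_w (\prod_i step l (a i) (W i w)) - 4 * M * L^-1)//.
have L1 : 1 <= L by rewrite /L ler1n.
have L0 : 0 < L by exact: lt_le_trans L1.
set n := (l.+1 ^ 5)%N; set k := L ^- 3.
have nL : n%:R = L ^+ 5 :> R by rewrite natrX.
have k0 : 0 <= k by rewrite invr_ge0 exprn_ge0 ?(ltW L0).
have n0 : (0 < n)%N by rewrite expn_gt0.
pose c i := a i - L^-1.
have [F FE] : is_trig (fun x => \prod_i step l (a i) (x i)).
  apply: is_trig_prod => i; exact: is_trig_phi.
have -> : \int[P2]_w (\prod_i step l (a i) (W i w)) = tmean (qform B) F.
  by rewrite -(gaussian_teval F gW) FE.
have -> : \int[P1]_w (\prod_i step l (a i) (V i w)) = tmean (qform A) F.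
  by rewrite -(gaussian_teval F gV) FE.
pose eps := (2 * n%:R * k) ^+ 2 * k ^+ 2.
have eps0 : 0 <= eps by rewrite mulr_ge0 ?sqr_ge0.
have epsE : eps = 4 * L ^- 2 by rewrite /eps nL /k; field; rewrite gt_eqF.
have F2 i j x : i != j -> - (eps * \sum_k (x k - c k) ^+ 2) <= teval (tderive2 i j F) x.
  move=> ij; have Ff y : teval F y = \prod_m step l (a m) (y m) by rewrite FE.
  have dff m (s : R) : is_derive s (1 : R) (step l (a m)) (dphi n k (c m) s).
    exact: is_derive_phi.
  rewrite (tderive2_prod Ff dff ij).
  set p := \prod_(_ | _) _.
  have /andP[p0 p1] : 0 <= p <= 1.
    rewrite prodr_ge0 ?prodr_ile1//= => m _; first exact: phi01.
    by case/andP: (phi01 n k (c m) (x m)).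
  have S0 m : (x m - c m) ^+ 2 <= \sum_k (x k - c k) ^+ 2.
    by rewrite (bigD1 m)//= lerDl sumr_ge0// => m' _; exact: sqr_ge0.
  have di := dphi_le (c i) (x i) n0 k0; have dj := dphi_le (c j) (x j) n0 k0.
  set u := dphi n k (c i) _ in di *; set v := dphi n k (c j) _ in dj *.
  have S_ge0 := le_trans (sqr_ge0 _) (S0 i).
  (* Beyond the monotone range of one coordinate, 1 <= k^2 |x - c|^2 turns the crude bound by the
     squared slope into a quadratic one. *)
  have far m : 1 < (k * (x m - c m)) ^+ 2 ->
      - (eps * \sum_k (x k - c k) ^+ 2) <= u * v * p.
    move=> km; apply: (@le_trans _ _ (- (2 * n%:R * k) ^+ 2)).
      have kS : 1 <= k ^+ 2 * \sum_k (x k - c k) ^+ 2.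
        by rewrite (le_trans (ltW km))// exprMn ler_wpM2l ?sqr_ge0.
      rewrite lerN2 /eps -(mulrA (_ ^+ 2)) -[leLHS]mulr1.
      by rewrite ler_wpM2l ?sqr_ge0.
    rewrite lerNl (le_trans (ler_norm _))// normrN normrM (ger0_norm p0).
    rewrite (@le_trans _ _ (`|u * v|))//; first by rewrite ler_piMr.
    by rewrite normrM expr2 ler_pM.
  have [ki|] := leP ((k * (x i - c i)) ^+ 2) 1; last exact: far.
  have [kj|] := leP ((k * (x j - c j)) ^+ 2) 1; last exact: far.
  (* Both slopes are nonpositive here, so their product has the right sign. *)
  apply: (@le_trans _ _ 0); first by rewrite oppr_le0 mulr_ge0.
  by rewrite mulr_ge0// mulr_le0// dphi_le0.
apply: le_trans (slepian_trig gV gW AB_diag AB_le F2 eps0).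
rewrite lerD2l lerN2 epsE -/D.
have ML : D * \sum_k 2 * (A k k + c k ^+ 2) <= M.
  rewrite /M ler_wpM2l//; apply: ler_sum => m _; rewrite ler_wpM2l// lerD2l.
  have i0 : 0 <= L^-1 by rewrite invr_ge0 ltW.
  have i1 : L^-1 <= 1 by rewrite invf_le1.
  by rewrite /c; move: (L^-1) i0 i1 => h h0 h1; have := sqr_ge0 (a m + h); nra.
apply: (@le_trans _ _ (4 * L ^- 2 * M)).
  by rewrite ler_wpM2l ?mulr_ge0 ?invr_ge0 ?exprn_ge0 ?(ltW L0).
rewrite [leRHS]mulrAC -!mulrA ler_wpM2l// mulrC [leRHS]mulrC ler_wpM2l//.
rewrite lef_pV2 ?posrE ?exprn_gt0//; exact: ler_eXnr.
Qed.

End slepian.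

(** * The comparison walk *)

Section ltr_indicator.
Context d (T : measurableType d) (R : realType).

Variables (f g : T -> R).
Hypotheses (mf : measurable_fun setT f) (mg : measurable_fun setT g).

Lemma measurable_lt : measurable [set w | f w < g w].
Proof.
have mfg := measurable_fun_ltr mf mg; rewrite -[[set w | _]]setTI.
exact: (mfg measurableT [set true]).
Qed.

Let lt_indic w : (f w < g w)%R%:R = \1_[set w | f w < g w] w :> R.
Proof. by rewrite indicE mem_setE. Qed.

Lemma bmeas_lt : bmeas (fun w => (f w < g w)%R%:R : R).
Proof.
by under eq_fun do rewrite lt_indic; exact/bmeas_indic/measurable_lt.
Qed.

Lemma Rint_lt (P : probability T R) :
  \int[P]_w ((f w < g w)%R%:R : R) = fine (P [set w | f w < g w]).
Proof.
rewrite -Rint_indic; last exact: measurable_lt.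
by apply: eq_Rintegral => w _; exact: lt_indic.
Qed.

End ltr_indicator.

(** * Gaussian convolution and the reflected distribution function *)

Section standard_normal.
Variable R : realType.
Local Notation gamma := (normal_prob (0 : R) 1).

Lemma std_normal_charfun t th :
  \int[gamma]_g cos (t * g + th) = cos th * expR (- (t ^+ 2 / 2)).
Proof.
rewrite Rintegral_normal_prob; last by apply: bmeas_cosD; exact: measurable_funM.
have := normal_pdf_charfun (0 : R) (oner_neq0 R) th t.
rewrite expr1n mul1r => <-.
by apply: eq_Rintegral => g _; rewrite subr0.
Qed.

(** Scaling the variable instead of the law covers s = 0, where the value is the indicator of 0 <
    y. *)
Definition ncdf (s y : R) : R := \int[gamma]_g ((s * g < y)%R%:R : R).

Lemma bmeas_ncdf s : bmeas (ncdf s).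
Proof.
have := @bmeas_Rint _ _ (measurableTypeR R) (measurableTypeR R) R gamma gamma
  (fun z => (s * z.2 < z.1)%R%:R).
apply; apply: bmeas_lt => //; exact: measurable_funM.
Qed.

Let bmeas_ncdf_section s y : bmeas (fun g : measurableTypeR R => (s * g < y)%R%:R : R).
Proof. by apply: bmeas_lt => //; exact: measurable_funM. Qed.

Lemma ncdf_le s y z : y <= z -> ncdf s y <= ncdf s z.
Proof.
move=> yz; apply: le_Rint => [||g]; try exact: bmeas_ncdf_section; rewrite ler_nat.
by case: (ltP (s * g)) => // /lt_le_trans /(_ yz) ->.
Qed.

Lemma ncdf01 s y : 0 <= ncdf s y <= 1.
Proof.
apply/andP; split; first by apply: Rintegral_ge0.
rewrite -[leRHS](Rint_cst gamma); apply: le_Rint => //; first exact: bmeas_cst.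
by move=> g; case: (_ < _).
Qed.

(** Slepian's inequality for a one-element family with equal variances, used in both directions,
    shows that the characteristic function determines the probability. *)
Lemma ncdf_conv s r t y : t ^+ 2 = s ^+ 2 + r ^+ 2 ->
  \int[gamma]_g ncdf s (y - r * g) = ncdf t y.
Proof.
move=> tsr.
pose Y (z : measurableTypeR R * measurableTypeR R) := r * z.1 + s * z.2.
have mY : measurable_fun setT Y.
  by apply: measurable_funD; exact: measurable_funM.
have gY : gaussian (prodP gamma gamma) (fun _ : 'I_1 => Y) (qform (fun _ _ => t ^+ 2)).
  split=> // a th; rewrite /qform !big_ord1.
  rewrite Rint_prod; last by apply: bmeas_cosD; apply: measurable_sum => i; exact: measurable_funM.
  under eq_Rintegral => x _.
    under eq_Rintegral => z _.
      rewrite big_ord1 /Y /= (_ : a ord0 * _ + th = a ord0 * s * z + (a ord0 * r * x + th)); last by ring.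
      over.
    rewrite std_normal_charfun mulrC; over.
  rewrite RintZ; last by apply: bmeas_cosD; exact: measurable_funM.
  rewrite std_normal_charfun mulrCA -expRD; congr (_ * expR _).
  by rewrite tsr; field.
have gX : gaussian gamma (fun (_ : 'I_1) (g : measurableTypeR R) => t * g) (qform (fun _ _ => t ^+ 2)).
  split=> [_|a th]; first exact: measurable_funM.
  rewrite /qform !big_ord1; under eq_Rintegral do rewrite big_ord1 mulrA.
  by rewrite std_normal_charfun; congr (_ * expR _); field.
have -> : \int[gamma]_g ncdf s (y - r * g) =
    fine (prodP gamma gamma (below (fun=> y) (fun _ : 'I_1 => Y))).
  rewrite -Rint_indic; last by apply: measurable_below.
  rewrite Rint_prod; last by apply: bmeas_indic; exact: measurable_below.
  apply: eq_Rintegral => g _; apply: eq_Rintegral => h _.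
  by rewrite below_indic big_ord1 /Y /= ltrBrDl.
have -> : ncdf t y = fine (gamma (below (fun=> y) (fun (_ : 'I_1) (g : measurableTypeR R) => t * g))).
  rewrite -Rint_indic; last by apply: measurable_below => _; exact: measurable_funM.
  by apply: eq_Rintegral => h _; rewrite below_indic big_ord1.
by apply/le_anti/andP; split; [apply: (slepian _ gX gY) | apply: (slepian _ gY gX)].
Qed.

(** For s > 0 and y >= 0, the probability that a Brownian motion does not reach y before time s^2.
    The odd extension past the barrier (method of images) is what makes it compatible with
    convolution. *)
Definition psi (s y : R) : R := ncdf s y - ncdf s (- y).

Lemma bmeas_psi s : bmeas (psi s).
Proof.
apply: bmeasB; first exact: bmeas_ncdf.
by apply: (bmeas_comp (bmeas_ncdf s)); exact: measurable_funN.
Qed.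

Lemma psi_le1 s y : psi s y <= 1.
Proof. by have := ncdf01 s y; have := ncdf01 s (- y); rewrite /psi; lra. Qed.

Lemma psi_le0 s y : y <= 0 -> psi s y <= 0.
Proof. by move=> y0; rewrite subr_le0 ncdf_le//; lra. Qed.

Lemma psi_conv s r t y : t ^+ 2 = s ^+ 2 + r ^+ 2 ->
  \int[gamma]_g psi s (y - r * g) = psi t y.
Proof.
move=> tsr; rewrite /psi RintB.
- congr (_ - _); first exact: ncdf_conv.
  have := @ncdf_conv s (- r) t (- y); rewrite sqrrN => /(_ tsr) <-.
  by apply: eq_Rintegral => g _; congr ncdf; ring.
- by apply: (bmeas_comp (bmeas_ncdf s)); apply: measurable_funB => //; exact: measurable_funM.
- apply: (bmeas_comp (bmeas_ncdf s)); apply: measurable_funN.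
  by apply: measurable_funB => //; exact: measurable_funM.
Qed.

End standard_normal.

Lemma charfun_noise d (T : measurableType d) (R : realType)
    (P : probability T R) (Y : T -> R) t : measurable_fun setT Y ->
  \int[prodP P (normal_prob (0 : R) 1)]_z cos (t * z.2 + Y z.1) =
  (\int[P]_w cos (Y w)) * expR (- (t ^+ 2 / 2)).
Proof.
move=> mY.
have bY : bmeas (fun w => cos (Y w)).
  by have := bmeas_cosD 0 mY; under eq_fun do rewrite addr0.
rewrite Rint_prod; last first.
  have := bmeas_cosD 0 (measurable_funD (measurable_funM (@measurable_cst _ _ _ _ setT t)
    (@measurable_snd _ _ T (measurableTypeR R))) (measurableT_comp mY measurable_fst)).
  by under eq_fun do rewrite addr0.
under eq_Rintegral do rewrite /= std_normal_charfun mulrC.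
by rewrite RintZ// mulrC.
Qed.

Section walk.
Variables (R : realType) (a c d s2 ph : nat -> R) (b : R).
Local Notation gamma := (normal_prob (0 : R) 1).

(** Indices start at 0: the walk leaves 0 at time [tau 0], and [W k] reads it at time [tau k.+1]. *)
Definition tau n := if n is k.+1 then c k / d k else 0.

(** For i < j this is d_i d_j (c_i / d_i), the covariance of two readings of the walk. On the
    diagonal the noise supplies what is missing from c_i d_i to [s2 i]. *)
Definition walk_cov i j := if i == j then s2 i else c (minn i j) * d (maxn i j).

Lemma walk_covC i j : walk_cov i j = walk_cov j i.
Proof. by rewrite /walk_cov eq_sym minnC maxnC; case: eqP => // ->. Qed.

(** The variance of \sum al_k W_k + x X. The mixed term uses the covariance d_k (c_k / d_k) = c_k of
    W_k with the current position X, which the induction has to carry along. *)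
Let q n (al : nat -> R) x :=
  \sum_(i < n) \sum_(j < n) al i * al j * walk_cov i j +
  2 * x * (\sum_(i < n) al i * c i) + x ^+ 2 * tau n.

Let qS n al x : d n != 0 -> tau n <= tau n.+1 ->  c n * d n <= s2 n ->
  q n al (al n * d n + x) +
    ((al n * d n + x) * Num.sqrt (tau n.+1 - tau n)) ^+ 2 +
    (al n * Num.sqrt (s2 n - c n * d n)) ^+ 2 = q n.+1 al x.
Proof.
move=> dn tn sn.
rewrite !exprMn !sqr_sqrtr ?subr_ge0// /q.
have -> : \sum_(i < n.+1) \sum_(j < n.+1) al i * al j * walk_cov i j =
    \sum_(i < n) \sum_(j < n) al i * al j * walk_cov i j +
    2 * (al n * d n) * (\sum_(i < n) al i * c i) + al n ^+ 2 * s2 n.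
  have row : \sum_(i < n) al n * al i * walk_cov n i = (al n * d n) * \sum_(i < n) al i * c i.
    rewrite mulr_sumr; apply: eq_bigr => i _.
    rewrite /walk_cov gtn_eqF// /minn /maxn ltnNge ltnW//=; ring.
  have col : \sum_(i < n) al i * al n * walk_cov i n = (al n * d n) * \sum_(i < n) al i * c i.
    rewrite -row; apply: eq_bigr => i _.
    by rewrite (walk_covC i) (mulrC (al i)).
  rewrite big_ord_recr /= big_ord_recr /= row.
  under eq_bigr do rewrite big_ord_recr /=.
  have diag : walk_cov n n = s2 n by rewrite /walk_cov eqxx.
  by rewrite big_split /= col diag; ring.
rewrite [in RHS]big_ord_recr /=; field; exact: dn.
Qed.

(** Since [psi] is nonpositive past the barrier, taking the positive part kills the walk there. *)
Let phi_plus s (y : R) := Num.max 0 (psi s y).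

Let bmeas_plus s : bmeas (phi_plus s).
Proof.
have [mp [M pM]] := bmeas_psi s; split; first exact: measurable_maxr.
exists 1 => y; rewrite ger0_norm ?le_max ?lexx// ge_max ler01 psi_le1//.
Qed.

(* W k = d k * X k.+1 + N k, where X is a Gaussian random walk with variances
   tau and N is an independent noise; the last clause is the reflection
   principle, the odd function psi of the remaining time playing the role of a
   martingale that is stopped when the walk exceeds b. *)
Let walk_spec n dd (T : measurableType dd) (P : probability T R)
    (X : T -> R) (W : nat -> T -> R) :=
  [/\ measurable_fun setT X, (forall k, measurable_fun setT (W k)),
   forall (al : nat -> R) x th,
     \int[P]_w cos (\sum_(k < n) al k * W k w + x * X w + th) =
     cos th * expR (- (q n al x / 2)) &
   forall s t, 0 <= s -> 0 <= t -> t ^+ 2 = s ^+ 2 + tau n ->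
     (\prod_(k < n) ph k) * psi t b <=
     \int[P]_w ((\prod_(k < n) ((W k w < a k)%R%:R : R)) * phi_plus s (b - X w))].

(** Two independent normals are adjoined: the increment of the walk, then the noise of the new
    variable. They are integrated out in the opposite order. *)
Let walk_step n dd (T : measurableType dd) (P : probability T R) X W :
  d n != 0 -> tau n <= tau n.+1 -> c n * d n <= s2 n ->
  (forall k, (k < n)%N -> 0 <= ph k) ->  0 <= ph n ->
  (forall x, x <= b -> ph n <=
     \int[gamma]_g ((d n * x + Num.sqrt (s2 n - c n * d n) * g < a n)%R%:R : R)) ->
  @walk_spec n dd T P X W ->
  let rho := Num.sqrt (tau n.+1 - tau n) in
  let X' z := X z.1.1 + rho * z.1.2 in
  walk_spec n.+1 (prodP (prodP P gamma) gamma) X'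
    (fun k z => if k == n then d n * X' z + Num.sqrt (s2 n - c n * d n) * z.2
      else W k z.1.1).
Proof.
move=> dn tn sn ph0 phn0 phn [mX mW cW lW] rho; set sg := Num.sqrt _.
move=> X'; set W' := fun k => _.
have mX' : measurable_fun setT X'.
  apply: measurable_funD.
    exact: (measurableT_comp mX (measurableT_comp measurable_fst measurable_fst)).
  apply: measurable_funM => //.
  exact: (measurableT_comp measurable_snd measurable_fst).
have mW' k : measurable_fun setT (W' k).
  rewrite /W'; case: (k == n).
    by apply: measurable_funD; apply: measurable_funM.
  exact: (measurableT_comp (mW k) (measurableT_comp measurable_fst measurable_fst)).
split=> //.
- move=> al x th.
  have WE z : \sum_(k < n.+1) al k * W' k z + x * X' z + th =
     (al n * sg) * z.2 + (((al n * d n + x) * rho) * z.1.2 +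
       (\sum_(k < n) al k * W k z.1.1 + (al n * d n + x) * X z.1.1 + th)).
    have last_W : W' n z = d n * X' z + sg * z.2 by rewrite /W' eqxx.
    rewrite big_ord_recr /= last_W.
    rewrite (eq_bigr (fun k : 'I_n => al k * W k z.1.1)); last first.
      by move=> k _; rewrite /W' ltn_eqF.
    by rewrite /X'; ring.
  have mrest : measurable_fun setT (fun w => \sum_(k < n) al k * W k w + (al n * d n + x) * X w + th).
    apply: measurable_funD => //; apply: measurable_funD; last exact: measurable_funM.
    by apply: measurable_sum => k; exact: measurable_funM.
  under eq_Rintegral do rewrite WE.
  have mY1 : measurable_fun setT (fun w : T * measurableTypeR R => (al n * d n + x) * rho * w.2 +
      (\sum_(k < n) al k * W k w.1 + (al n * d n + x) * X w.1 + th)).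
    apply: measurable_funD; first exact: measurable_funM.
    exact: (measurableT_comp mrest measurable_fst).
  rewrite (charfun_noise (prodP P gamma) _ mY1).
  rewrite (charfun_noise P _ mrest) cW -!mulrA -!expRD -(qS al x dn tn sn).
  by congr (_ * expR _); rewrite -/rho -/sg; field.
- move=> s t s0 t0 ts; rewrite big_ord_recr /=.
  have rho2 : rho ^+ 2 = tau n.+1 - tau n by rewrite sqr_sqrtr// subr_ge0.
  (* The time remaining before the increment, at which the induction hypothesis is used. *)
  set s' := Num.sqrt (s ^+ 2 + rho ^+ 2).
  have s'2 : s' ^+ 2 = s ^+ 2 + rho ^+ 2 by rewrite sqr_sqrtr// addr_ge0 ?sqr_ge0.
  have := lW s' t (sqrtr_ge0 _) t0.
  have -> : t ^+ 2 = s' ^+ 2 + tau n by rewrite s'2 ts rho2; ring.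
  move=> /(_ erefl) IH.
  pose Pi w : R := \prod_(k < n) ((W k w < a k)%R%:R : R).
  have bPi : bmeas Pi.
    by apply: bmeas_prod => k; apply: bmeas_lt.
  have Pi0 w : 0 <= Pi w by apply: prodr_ge0.
  have mX1 : measurable_fun setT (fun v : T * measurableTypeR R => b - (X v.1 + rho * v.2)).
    apply: measurable_funB => //; apply: measurable_funD.
      exact: (measurableT_comp mX measurable_fst).
    exact: measurable_funM.
  pose A (v : T * measurableTypeR R) := Pi v.1 * phi_plus s (b - (X v.1 + rho * v.2)).
  have bA : bmeas A.
    apply: bmeasM; first exact: (bmeas_comp bPi measurable_fst).
    exact: (bmeas_comp (bmeas_plus s) mX1).
  have A0 v : 0 <= A v by rewrite mulr_ge0// le_max lexx.
  have GE z : \prod_(k < n.+1) ((W' k z < a k)%R%:R : R) * phi_plus s (b - X' z) =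
      A z.1 * ((d n * (X z.1.1 + rho * z.1.2) + sg * z.2 < a n)%R%:R).
    have last_W : W' n z = d n * (X z.1.1 + rho * z.1.2) + sg * z.2 by rewrite /W' eqxx.
    rewrite big_ord_recr /= last_W /A /Pi -mulrA (mulrC (_%:R)) mulrA.
    congr (_ * _ * _); apply: eq_bigr => k _.
    by rewrite /W' ltn_eqF.
  have bN : bmeas (fun z : T * measurableTypeR R * measurableTypeR R =>
      ((d n * (X z.1.1 + rho * z.1.2) + sg * z.2 < a n)%R%:R : R)).
    by apply: bmeas_lt => //; apply: measurable_funD; apply: measurable_funM.
  have bG : bmeas (fun z : T * measurableTypeR R * measurableTypeR R =>
      A z.1 * ((d n * (X z.1.1 + rho * z.1.2) + sg * z.2 < a n)%R%:R)).
    by apply: bmeasM => //; exact: (bmeas_comp bA measurable_fst).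
  under eq_Rintegral do rewrite GE.
  rewrite (Rint_prod _ _ bG).
  (* Integrating out the noise gains at least [ph n] where the walk is at most b; elsewhere [A]
     vanishes. *)
  apply: (@le_trans _ _ (\int[prodP P gamma]_v (ph n * A v))); last first.
    apply: le_Rint; [exact: bmeasZ | exact: (bmeas_Rint (prodP P gamma) gamma bG) |].
    move=> v /=; have /= bv := bmeas_section bN v; rewrite (RintZ _ _ bv).
    rewrite mulrC; have [Xb|bX] := leP (X v.1 + rho * v.2) b.
      by rewrite ler_wpM2l// phn.
    by rewrite /A /phi_plus max_l ?psi_le0 ?mulr0 ?mul0r// subr_le0 ltW.
  rewrite RintZ// (mulrC _ (ph n)) -mulrA ler_wpM2l//.
  apply: le_trans IH _; rewrite (Rint_prod _ _ bA); apply: le_Rint.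
  - apply: bmeasM => //; apply: (bmeas_comp (bmeas_plus s')).
    exact: measurable_funB.
  - exact: (bmeas_Rint P gamma bA).
  move=> w; have bw : bmeas (fun g : measurableTypeR R => phi_plus s (b - (X w + rho * g))).
    by apply: (bmeas_comp (bmeas_plus s)); exact: (measurableT_comp mX1 (measurable_pair1 w)).
  rewrite /A /= (RintZ _ _ bw); apply: ler_wpM2l; first exact: Pi0.
  (* Jensen's inequality for the positive part, with [psi_conv] as the martingale identity: stopping
     can only increase the integral. *)
  rewrite [leLHS]/phi_plus ge_max; apply/andP; split.
    by apply: Rintegral_ge0 => g _; rewrite le_max lexx.
  rewrite -(psi_conv (s := s) (r := rho) (t := s'))//; apply: le_Rint => //.
    by apply: (bmeas_comp (bmeas_psi s)); exact: measurable_funB.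
  by move=> g; rewrite opprD addrA le_max lexx orbT.
Qed.

Variable m : nat.
Hypotheses (d0 : forall k, (k < m)%N -> d k != 0)
  (tau_le : forall k, (k < m)%N -> tau k <= tau k.+1)
  (cd_le : forall k, (k < m)%N -> c k * d k <= s2 k)
  (ph_ge0 : forall k, (k < m)%N -> 0 <= ph k)
  (ph_le : forall k x, (k < m)%N -> x <= b -> ph k <=
     \int[gamma]_g ((d k * x + Num.sqrt (s2 k - c k * d k) * g < a k)%R%:R : R)).

(** The probability space is quantified because every step enlarges it. *)
Let walk_exists n : (n <= m)%N ->
  exists (dd : measure_display) (T : measurableType dd) (P : probability T R)
    (X : T -> R) (W : nat -> T -> R), walk_spec n P X W.
Proof.
elim: n => [_|n IH nm].
  exists _, (measurableTypeR R), gamma, (fun=> 0), (fun _ _ => 0).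
  split=> // [al x th|s t s0 t0].
    under eq_Rintegral do rewrite big_ord0 mulr0 !add0r.
    rewrite Rint_cst /q !big_ord0 mulr0 /tau mulr0 !addr0 mul0r oppr0 expR0.
    by rewrite mulr1.
  rewrite addr0 => /eqP; rewrite eqrXn2// => /eqP ->.
  under eq_Rintegral do rewrite big_ord0 mul1r subr0.
  by rewrite Rint_cst big_ord0 mul1r le_max lexx orbT.
have [dd [T [P [X [W H]]]]] := IH (ltnW nm).
do 5 eexists; apply: (walk_step _ _ _ _ _ _ H) => //.
- exact: d0.
- exact: tau_le.
- exact: cd_le.
- by move=> k kn; apply: ph_ge0; exact: ltn_trans nm.
- exact: ph_ge0.
- by move=> x; exact: ph_le.
Qed.

Lemma gaussian_walk t : 0 <= t -> t ^+ 2 = tau m ->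
  exists (dd : measure_display) (T : measurableType dd) (P : probability T R)
    (W : nat -> T -> R),
    gaussian P (fun k : 'I_m => W k) (qform (fun i j : 'I_m => walk_cov i j)) /\
    (\prod_(k < m) ph k) * psi t b <=
    fine (P (below (fun k : 'I_m => a k) (fun k : 'I_m => W k))).
Proof.
move=> t0 tm; have [dd [T [P [X [W [mX mW cW lW]]]]]] := walk_exists (leqnn m).
exists dd, T, P, W; split.
  split=> [k|al th]; first exact: mW.
  (* The walk takes coefficients on [nat]; the value 0 beyond m is never read. *)
  pose al' k := if insub k is Some i then al i else 0.
  have alE (i : 'I_m) : al' i = al i by rewrite /al' valK.
  have := cW al' 0 th.
  rewrite /q mulr0 mul0r expr0n /= mul0r !addr0 => E.
  rewrite (_ : qform _ _ = \sum_(i < m) \sum_(j < m) al' i * al' j * walk_cov i j).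
    rewrite -E; apply: eq_Rintegral => w _; rewrite mul0r addr0.
    by congr (cos (_ + _)); apply: eq_bigr => i _; rewrite alE.
  by apply: eq_bigr => i _; apply: eq_bigr => j _; rewrite !alE.
have := lW 0 t (lexx _) t0; rewrite expr0n /= add0r => /(_ tm) H.
apply: le_trans H _; rewrite -Rint_indic; last first.
  by apply: measurable_below => k; exact: mW.
apply: le_Rint.
- apply: bmeasM; first by apply: bmeas_prod => k; exact: bmeas_lt.
  by apply: (bmeas_comp (bmeas_plus 0)); exact: measurable_funB.
- by apply: bmeas_indic; apply: measurable_below => k; exact: mW.
move=> w; rewrite below_indic ler_piMr//; first by apply: prodr_ge0.
by rewrite ge_max ler01 psi_le1.
Qed.

End walk.

(** * Passage to the quantities of the statement *)

Lemma bigmin_seq_le (R : realType) (s : seq nat) (F : nat -> R) x j :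
  j \in s -> \big[Num.min/x]_(i <- s) F i <= F j.
Proof.
elim: s => // k s IH; rewrite inE big_cons ge_min => /predU1P[->|/IH ->].
  by rewrite lexx.
by rewrite orbT.
Qed.

Lemma bigmin_seq_ge0 (R : realType) (s : seq nat) (F : nat -> R) x :
  0 <= x -> (forall j, j \in s -> 0 <= F j) -> 0 <= \big[Num.min/x]_(i <- s) F i.
Proof.
move=> x0 F0; elim: s F0 => [|k s IH] F0; first by rewrite big_nil.
rewrite big_cons le_min F0 ?mem_head//= IH// => j js; apply: F0.
by rewrite inE js orbT.
Qed.

Section normal_values.
Variable R : realType.
Local Notation gamma := (normal_prob (0 : R) 1).
Local Notation mu := (@lebesgue_measure R).

Let ncdf1E y : ncdf 1 y = fine (gamma `]-oo, y[).
Proof.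
rewrite /ncdf Rint_lt//.
by congr (fine (gamma _)); apply/seteqP; split => g; rewrite /= in_itv/= mul1r.
Qed.

(** One side uses the closed half-line and the other the open one; the law has no atoms. *)
Lemma PhiE (y : R) : Phi y = ncdf 1 y.
Proof.
rewrite ncdf1E /Phi -[LHS]/(\int[mu]_(x in `]-oo, y]) normal_pdf 0 1 x).
rewrite -Rintegral_itv_bndo_bndc//.
exact: integrableS (integrable_normal_pdf (0 : R) 1).
Qed.

Lemma ncdf_scale (s y : R) : 0 < s -> ncdf s y = ncdf 1 (y / s).
Proof.
move=> s0; apply: eq_Rintegral => g _; congr (_%:R).
by rewrite mul1r ltr_pdivlMr// mulrC.
Qed.

Lemma psi_integral (t b : R) : 0 < t -> 0 <= b ->
  psi t b = \int[mu]_(x in `[- (b / t), b / t])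
    (expR (- x ^+ 2 / 2) / Num.sqrt (2 * pi)).
Proof.
move=> t0 b0; rewrite /psi (ncdf_scale b t0) (ncdf_scale (- b) t0) mulNr; set B := b / t.
have B0 : 0 <= B by rewrite divr_ge0// ltW.
have iP := integrable_normal_pdf (0 : R) 1.
have -> : \int[mu]_(x in `[- B, B]) (expR (- x ^+ 2 / 2) / Num.sqrt (2 * pi)) =
    \int[mu]_(x in `[- B, B[) normal_pdf 0 1 x.
  rewrite Rintegral_itv_bndo_bndc; last exact: integrableS iP.
  apply: eq_Rintegral => x _; rewrite normal_pdfE ?oner_neq0// /normal_fun /normal_peak.
  by rewrite subr0 expr1n mul1r [RHS]mulrC mulr_natl.
rewrite !ncdf1E.
have -> : gamma `]-oo, B[ = adde (gamma `]-oo, - B[) (gamma `[- B, B[).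
  have disj : `]-oo, (- B)[%classic `&` `[- B, B[%classic = set0 :> set R.
    apply/seteqP; split => x //=; rewrite !in_itv/= => -[xB /andP[Bx _]].
    by move: xB; rewrite ltNge Bx.
  have U := measureU gamma (measurable_itv `]-oo, (- B)[) (measurable_itv `[(- B), B[) disj.
  rewrite -[RHS]U; congr (gamma _).
  by rewrite -itv_bndbnd_setU//= ?bnd_simp; lra.
by rewrite fineD ?fin_num_measure// addrAC subrr add0r.
Qed.

End normal_values.

Lemma gaussian_scale d (T : measurableType d) (R : realType)
    (P : probability T R) (I : finType) (X : I -> T -> R) (K : I -> I -> R) (s : I -> R) :
  gaussian P X (qform K) ->
  gaussian P (fun i w => s i * X i w) (qform (fun i j => s i * s j * K i j)).
Proof.
move=> [mX cX]; split=> [i|a th]; first exact: measurable_funM.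
have -> : qform (fun i j => s i * s j * K i j) a = qform K (fun i => a i * s i).
  by apply: eq_bigr => i _; apply: eq_bigr => j _; ring.
rewrite -cX; apply: eq_Rintegral => w _; congr (cos (_ + _)).
by apply: eq_bigr => i _; rewrite mulrA.
Qed.

Unset Implicit Arguments.
Set Strict Implicit.
Set Printing Implicit Defensive.

Theorem proposition2 (R : realType)
    (dT : measure_display) (T : measurableType dT) (P : probability T R)
    (n : nat) (Z : nat -> {RV P >-> R}) :
  let r i j : R := fine 'E_P[Z i \* Z j]%E in
  jointly_normal (fun i : 'I_n => Z i.+1) ->
  (forall i, (1 <= i <= n)%N -> ('E_P[Z i] = 0)%E) ->
  (forall i, (1 <= i <= n)%N -> ('E_P[fun w => (Z i w ^+ 2)%R] = 1)%E) ->
  (forall i j, (1 <= i <= n)%N -> (1 <= j <= n)%N -> i <> j ->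
     `|r i j| < 1) ->
  forall (m : nat) (u h : R),
  (2 <= m <= n)%N -> 0 <= u -> 0 <= h ->
  (forall j, (1 <= j < m)%N ->
     0 <= (u - r j m * (u + h)) / Num.sqrt (1 - r j m ^+ 2)) ->
  forall (dS : measure_display) (S : measurableType dS)
    (Q : probability S R) (V : nat -> {RV Q >-> R}),
  is_conditional_family r m V ->
  forall c d : nat -> R,
  (forall j, (1 <= j < m)%N -> 0 < c j /\ 0 < d j) ->
  (forall j k, (1 <= j)%N -> (j <= k)%N -> (k < m)%N ->
     c j / d j <= c k / d k) ->
  (forall j k, (1 <= j < m)%N -> (1 <= k < m)%N ->
     c (minn j k) * d (maxn j k) < r j k - r j m * r k m) ->
  forall delta : R, 0 <= delta ->
  let B := Bdelta r u h m c d delta in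
  (Pmh r u V m h >=
    ((\int[lebesgue_measure]_(t in `[- B, B])
        (expR (- t ^+ 2 / 2) / Num.sqrt (2 * pi)))
     * \prod_(1 <= j < m)
         Phi ((1 - delta) * (u - r j m * (u + h))
              / Num.sqrt (1 - r j m ^+ 2 - c j * d j)))%R%:E)%E.
Proof.
move=> r _ _ EZ2 r1 m u h /andP[m2 mn] u0 h0 a_ge0 dS S Q V [jV EV _ EVV] c d cd0.
move=> cd_mono cd_lt delta delta0; lazy zeta.
(* Indices are shifted from 1, ..., m - 1 to 0, ..., m - 2. *)
pose a k := u - r k.+1 m * (u + h).
pose s2 k := 1 - r k.+1 m ^+ 2.
pose c' k := c k.+1; pose d' k := d k.+1.
have jm (k : nat) : (k < m.-1)%N -> (1 <= k.+1 < m)%N by move=> km; lia.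
have s2_gt0 k : (k < m.-1)%N -> 0 < s2 k.
  move=> km; have rk : `|r k.+1 m| < 1 by apply: r1; lia.
  by rewrite subr_gt0 -real_normK ?num_real// expr_lt1.
have a0 k : (k < m.-1)%N -> 0 <= a k.
  move=> km; have := a_ge0 _ (jm k km).
  by rewrite pmulr_lge0// invr_gt0 sqrtr_gt0 s2_gt0.
have r_diag i : (1 <= i <= n)%N -> r i i = 1.
  move=> im; have E := EZ2 i im; rewrite unlock in E.
  rewrite /r unlock -[RHS]/(fine 1%E) -E; congr fine.
have c0 k : (k < m.-1)%N -> 0 < c' k by move=> /jm/cd0[].
have d0 k : (k < m.-1)%N -> 0 < d' k by move=> /jm/cd0[].
(* Condition (ii) with j = k says that the noise has positive variance. *)
have sg_gt0 k : (k < m.-1)%N -> 0 < s2 k - c' k * d' k.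
  move=> km; have := cd_lt _ _ (jm k km) (jm k km).
  by rewrite minnn maxnn r_diag ?subr_gt0 -?expr2//; lia.
pose b := delta * min_range m (fun j => (u - r j m * (u + h)) / d j).
have fracE k : (u - r k.+1 m * (u + h)) / d k.+1 = a k / d' k by [].
have min0 : 0 <= min_range m (fun j => (u - r j m * (u + h)) / d j).
  apply: bigmin_seq_ge0 => [|j]; first by rewrite fracE divr_ge0 ?a0 ?(ltW (d0 _ _))//; lia.
  rewrite mem_index_iota; case: j => // k km.
  by rewrite fracE divr_ge0 ?a0 ?(ltW (d0 _ _))//; lia.
have b_ge0 : 0 <= b by rewrite mulr_ge0.
have b_le k : (k < m.-1)%N -> d' k * b <= delta * a k.
  move=> km; rewrite mulrC -ler_pdivlMr ?d0// -mulrA ler_wpM2l// -fracE.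
  by apply: bigmin_seq_le; rewrite mem_index_iota jm.
pose ph k := Phi ((1 - delta) * a k / Num.sqrt (s2 k - c' k * d' k)).
have ph_ge0 k : (k < m.-1)%N -> 0 <= ph k.
  by move=> _; rewrite /ph PhiE; case/andP: (ncdf01 1 ((1 - delta) * a k / Num.sqrt (s2 k - c' k * d' k))).
have ph_le k x : (k < m.-1)%N -> x <= b -> ph k <= \int[normal_prob (0 : R) 1]_g
    ((d' k * x + Num.sqrt (s2 k - c' k * d' k) * g < a k)%R%:R : R).
  move=> km xb; rewrite /ph PhiE.
  have sq0 : 0 < Num.sqrt (s2 k - c' k * d' k) by rewrite sqrtr_gt0 sg_gt0.
  rewrite -(ncdf_scale _ sq0) /ncdf; apply: le_Rint.
  - by apply: bmeas_lt.
  - by apply: bmeas_lt => //; apply: measurable_funD.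
  move=> g; rewrite ler_nat; case: (ltP _ ((1 - delta) * a k)) => // sga.
  have dx : d' k * x <= d' k * b by rewrite ler_wpM2l// ltW// d0.
  by have -> : d' k * x + Num.sqrt (s2 k - c' k * d' k) * g < a k by have := b_le k km; lra.
have tau_le k : (k < m.-1)%N -> tau c' d' k <= tau c' d' k.+1.
  move=> km; rewrite /tau; case: k km => [|k] km.
    by rewrite divr_ge0// ltW ?c0 ?d0.
  by apply: cd_mono; lia.
have dn0 k : (k < m.-1)%N -> d' k != 0 by move=> /d0/gt_eqF ->.
have cd_le k : (k < m.-1)%N -> c' k * d' k <= s2 k.
  by move=> /sg_gt0; rewrite subr_gt0 => /ltW.
(* The standard deviation of the walk at its final time; b / t will be B(delta). *)
pose t := Num.sqrt (tau c' d' m.-1).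
have mE : m.-1 = m.-2.+1 by lia.
have tau_gt0 : 0 < tau c' d' m.-1.
  by rewrite mE /= divr_gt0 ?c0 ?d0//; lia.
have t0 : 0 < t by rewrite sqrtr_gt0.
have tE : t ^+ 2 = tau c' d' m.-1 by rewrite sqr_sqrtr// ltW.
have [dW [TW [PW [W [gW lW]]]]] :=
  gaussian_walk dn0 tau_le cd_le ph_ge0 ph_le (ltW t0) tE.
pose K (i j : 'I_m.-1) := (r i.+1 j.+1 - r i.+1 m * r j.+1 m) /
  Num.sqrt ((1 - r i.+1 m ^+ 2) * (1 - r j.+1 m ^+ 2)).
have gV0 : gaussian Q (fun (i : 'I_m.-1) w => V i.+1 w) (qform K).
  apply: (jointly_normal_gaussian jV) => [i|i j]; first by rewrite EV ?jm.
  by rewrite EVV ?jm.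
(* Undoing the normalization of V gives the covariances of condition (ii) and turns the thresholds
   into [a]. *)
have gV := gaussian_scale (fun i : 'I_m.-1 => Num.sqrt (s2 i)) gV0.
have covE (i j : 'I_m.-1) :
    Num.sqrt (s2 i) * Num.sqrt (s2 j) * K i j = r i.+1 j.+1 - r i.+1 m * r j.+1 m.
  rewrite /K -/(s2 i) -/(s2 j) sqrtrM ?ltW ?s2_gt0// mulrC divfK//.
  by rewrite mulf_neq0// gt_eqF// sqrtr_gt0 s2_gt0.
have slep : fine (PW (below (fun k : 'I_m.-1 => a k) (fun k : 'I_m.-1 => W k))) <=
    fine (Q (below (fun k : 'I_m.-1 => a k)
      (fun (i : 'I_m.-1) w => Num.sqrt (s2 i) * V i.+1 w))).
  apply: (slepian _ gV gW) => [i|i j ij].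
    by rewrite covE /walk_cov eqxx r_diag -?expr2//; have := ltn_ord i; lia.
  rewrite covE /walk_cov (negbTE ij : (i == j :> nat) = false) /c' /d' -minnSS -maxnSS.
  by rewrite ltW// cd_lt ?jm.
apply: (@le_trans _ _ (fine (Q (below (fun k : 'I_m.-1 => a k)
      (fun (i : 'I_m.-1) w => Num.sqrt (s2 i) * V i.+1 w))))%:E).
  rewrite lee_fin (le_trans _ slep)// (le_trans _ lW)//.
  rewrite mulrC (psi_integral t0 b_ge0).
  have -> : Bdelta r u h m c d delta = b / t.
    rewrite /Bdelta /b /t mE /= -/(c' _) -/(d' _) mulrAC; congr (_ * _).
    by rewrite -sqrtrV ?invf_div// divr_ge0// ltW ?c0 ?d0//; lia.
  by rewrite big_add1 big_mkord.
have mV' (i : 'I_m.-1) : measurable_fun setT (fun w => Num.sqrt (s2 i) * V i.+1 w).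
  exact: measurable_funM.
rewrite fineK ?fin_num_measure//; last exact: measurable_below.
rewrite /Pmh; apply: le_measure; rewrite ?inE.
- exact: measurable_below.
- rewrite (_ : [set w | _] = \bigcap_(i in [set: 'I_m.-1])
      (V i.+1 @^-1` `]-oo, a i / Num.sqrt (s2 i)])).
    apply: fin_bigcap_measurable => [|i _]; first exact: finite_finset.
    by rewrite -[_ @^-1` _]setTI; apply: measurable_funP.
  apply/seteqP; split => w /= Vw.
    by move=> i _; rewrite /= in_itv/=; apply: Vw; rewrite jm.
  case=> // j jm'; have jm1 : (j < m.-1)%N by lia.
  by have := Vw (Ordinal jm1) Logic.I; rewrite /= in_itv.
(* The strict event lies inside the one with weak inequalities, which suffices for a lower bound. *)
- move=> w Vw [|j]// jm'; have jm1 : (j < m.-1)%N by lia.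
  have := Vw (Ordinal jm1); rewrite /= mulrC -ltr_pdivlMr ?sqrtr_gt0 ?s2_gt0//.
  exact: ltW.
Qed.
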